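(* Let $m \geq 2$, let $D \subset \mathbb{R}^m$ be a domain, and let $u \in C^2(D)$ be harmonic in $D$. Then for every $x \in D$ and every $r > 0$ with $\overline{B_r(x)} \subset D$, \[ (m\,\alpha^{-1} - 1)\, r^{\alpha - m}\, u(x) = \frac{1}{|B_r|} \int_{B_r(x)} u(y) \left[ |x-y|^{\alpha-m} - r^{\alpha-m} \right] \mathrm{d}y \quad \text{for every } \alpha \in (0,m), \] and \[ \left[ 1 - \frac{m}{m+\beta} \right] r^\beta\, u(x) = \frac{1}{|B_r|} \int_{B_r(x)} u(y) \left[ r^\beta - |x-y|^\beta \right] \mathrm{d}y \quad \text{for every } \beta > 0 . \] Moreover, for any $x \in \mathbb{R}^m$, $r>0$, $\alpha \in (0,m)$ and $\beta>0$, both functions $y \mapsto |x-y|^{\alpha-m} - r^{\alpha-m}$ and $y \mapsto r^\beta - |x-y|^\beta$ are integrable over any bounded domain.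
   Context: $B_r(x) = \{y : |y-x| < r\}$ and $|B_r|$ denotes its Lebesgue measure. *)

(* Defs.v *)
From HB Require Import structures.
From mathcomp Require Import all_boot all_order all_algebra.
From mathcomp Require Import all_classical all_reals all_analysis.
Import Order.TTheory GRing.Theory Num.Theory.
Import numFieldNormedType.Exports.

Set Implicit Arguments.
Unset Strict Implicit.
Unset Printing Implicit Defensive.

Local Open Scope classical_set_scope.
Local Open Scope ring_scope.

Section Defs.
Variable R : realType.

(* m-dimensional Lebesgue measure, built on m.-tuple R (equipped with  *)
(* the product sigma-algebra of Borel sets of R) as the iterated       *)
(* product of the one-dimensional Lebesgue measure.                    *)

Definition tcons n (p : (n.-tuple R * measurableTypeR R)%type) : n.+1.-tuple R :=
  [tuple of p.2 :: p.1].

Lemma measurable_tcons n :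
  measurable_fun [set: (n.-tuple R * measurableTypeR R)%type] (@tcons n).
Proof. apply: measurable_cons; [exact: measurable_snd | exact: measurable_fst]. Qed.

Fixpoint lebn (n : nat) : {measure set (n.-tuple R) -> \bar R} :=
  match n with
  | 0 => [the measure _ _ of @dirac _ _ [tuple] R]
  | k.+1 => measure_function_pushforward__canonical__measure_function_Measure
              (lebn k \x (@lebesgue_measure R))%E (@measurable_tcons k)
  end.

Definition row_of n (t : n.-tuple R) : 'rV[R]_n := \row_(i < n) tnth t i.

Definition enorm n (v : 'rV[R]_n) : R := Num.sqrt (\sum_(i < n) v ord0 i ^+ 2).

Definition eball n (x : 'rV[R]_n) (r : R) : set 'rV[R]_n :=
  [set y | enorm (y - x) < r].

Definition ball_vol n (r : R) : R :=
  fine (lebn n [set t | eball 0 r (row_of t)]).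

Definition is_domain n (D : set 'rV[R]_n) : Prop :=
  D !=set0 /\ open D /\ connected D.

Definition partial n (i : 'I_n) (f : 'rV[R]_n -> R) : 'rV[R]_n -> R :=
  fun x => 'D_(delta_mx ord0 i) f x.

Definition C2_on n (D : set 'rV[R]_n) (f : 'rV[R]_n -> R) : Prop :=
  forall x, D x ->
    {for x, continuous f} /\
    forall i : 'I_n,
      derivable f x (delta_mx ord0 i) /\ {for x, continuous (partial i f)} /\
      forall j : 'I_n,
        derivable (partial i f) x (delta_mx ord0 j) /\
        {for x, continuous (partial j (partial i f))}.

Definition is_harmonic n (D : set 'rV[R]_n) (u : 'rV[R]_n -> R) : Prop :=
  C2_on D u /\ forall x, D x -> \sum_(i < n) partial i (partial i u) x = 0.

End Defs.
Arguments lebn {R} n.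

(* Main.v *)
(** Only coordinate derivatives and chords of balls are needed. A function [g] vanishing on a
    sphere integrates [d_i g] to 0 on every chord parallel to the i-th axis, hence on the ball.
    Let [w (y) = (|y - x|^2 - s^2) / 2]. For [g_i = d_i u * w] and [u] harmonic, summing over [i]
    gives [\int_{B_s(x)} grad u (y) . (y - x) dy = 0] for all [s]; for [g_i = u * (y_i - x_i) * w]
    it gives [\int_{B_s(x)} (grad u . (y - x)) w + (m + 2) u w + s^2 u = 0]. Writing
    [r^p - |y - x|^p] as the integral of [p s^(p - 1)] over [|y - x| < s < r] and exchanging the
    integrals expresses integrals of radially weighted functions through their integrals over balls
    ("layer cake"). With [p = 2] it kills the gradient term and turns the second identity, for
    [Phi (s) = \int_{B_s(x)} u], into [s^2 Phi (s) = (m + 2) \int_0^s a Phi (a) da]. So [Phi (s)] is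
    proportional to [s^m], and by continuity [Phi (s) = |B_s| u (x)]. The layer cake for [p > - m]
    then yields [\int_{B_r(x)} u (y) (r^p - |x - y|^p) dy = p / (p + m) r^p |B_r| u (x)]; the two
    formulas are the cases [p = a - m] and [p = b]. *)
Require Import Defs.
From HB Require Import structures.
From mathcomp Require Import all_boot all_order all_algebra.
From mathcomp Require Import all_classical all_reals all_analysis.
From mathcomp Require Import measurable_realfun ring lra.
Import Order.TTheory GRing.Theory Num.Theory.
Import numFieldNormedType.Exports.
Set Implicit Arguments.
Unset Strict Implicit.
Unset Printing Implicit Defensive.
Local Open Scope classical_set_scope.
Local Open Scope ring_scope.

Arguments row_of {R n} t.

Lemma norm_coord_le {R : realType} {m n : nat} (A : 'M[R]_(m, n)) i j : `|A i j| <= `|A|.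
Proof. by rewrite [leRHS]mx_normrE; apply/bigmax_geP; right => /=; exists (i, j). Qed.

Section euclidean_norm.
Context {R : realType} {n : nat}.
Implicit Types (x y v : 'rV[R]_n) (r : R).

Lemma enorm_ge0 v : 0 <= enorm v.
Proof. exact: sqrtr_ge0. Qed.

Lemma enorm_sqr v : enorm v ^+ 2 = \sum_i v ord0 i ^+ 2.
Proof. by rewrite sqr_sqrtr// sumr_ge0// => i _; rewrite sqr_ge0. Qed.

Lemma enorm_eq0 v : (enorm v == 0) = (v == 0).
Proof.
rewrite -sqrf_eq0 enorm_sqr psumr_eq0/=; last by move=> i _; rewrite sqr_ge0.
apply/allP/eqP => [v0|-> i _]; last by rewrite mxE expr0n.
by apply/rowP => i; rewrite mxE; apply/eqP; rewrite -sqrf_eq0 v0// mem_index_enum.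
Qed.

Lemma enormZ (a : R) v : enorm (a *: v) = `|a| * enorm v.
Proof.
rewrite /enorm; under eq_bigr do rewrite mxE exprMn.
by rewrite -mulr_sumr sqrtrM ?sqr_ge0// sqrtr_sqr.
Qed.

Lemma enorm_distC x y : enorm (x - y) = enorm (y - x).
Proof. by rewrite -opprB -scaleN1r enormZ normrN1 mul1r. Qed.

Lemma norm_le_enorm v : `|v| <= enorm v.
Proof.
rewrite [`|v|]mx_normrE; apply/bigmax_leP; split => [|[i j] _ /=]; first exact: enorm_ge0.
rewrite (ord1 i) -ler_sqr ?nnegrE ?enorm_ge0// enorm_sqr real_normK ?num_real//.
by rewrite (bigD1 j)//= lerDl sumr_ge0// => k _; rewrite sqr_ge0.
Qed.

Lemma enorm_le_norm v : enorm v <= Num.sqrt n%:R * `|v|.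
Proof.
rewrite -ler_sqr ?nnegrE ?enorm_ge0 ?mulr_ge0 ?sqrtr_ge0// enorm_sqr exprMn sqr_sqrtr//.
rewrite mulr_natl -[X in _ *+ X]card_ord -sumr_const; apply: ler_sum => i _.
by rewrite -real_normK ?num_real// lerXn2r ?nnegrE ?norm_coord_le.
Qed.

Lemma continuous_enorm : continuous (@enorm R n).
Proof.
move=> v; apply: (@continuous_comp _ _ _ (fun v : 'rV[R]_n => \sum_i v ord0 i ^+ 2)).
  apply: continuous_big; first exact: add_continuous.
  move=> i _ w; apply: (@continuous_comp _ _ _ (fun v => v ord0 i) (fun a => a ^+ 2)).
    exact: coord_continuous.
  exact: exprn_continuous.
exact: sqrt_continuous.
Qed.

Lemma continuous_enormB x : continuous (fun y => enorm (y - x)).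
Proof.
move=> y; apply: (@continuous_comp _ _ _ (fun y => y - x)); last exact: continuous_enorm.
by apply: continuousB => //; exact: cst_continuous.
Qed.

Lemma eball_center x r : 0 < r -> eball x r x.
Proof.
have /eqP enorm0 : enorm (0 : 'rV[R]_n) == 0 by rewrite enorm_eq0.
by rewrite /eball/= subrr enorm0.
Qed.

Lemma sub_eball x r s : r <= s -> eball x r `<=` eball x s.
Proof. by move=> rs y yr; exact: lt_le_trans yr rs. Qed.

Lemma open_eball x r : open (eball x r).
Proof.
apply: (@open_comp _ _ (fun y => enorm (y - x)) [set s | s < r]); last exact: open_lt.
by move=> y _; exact: continuous_enormB.
Qed.

Definition closed_eball x r : set 'rV[R]_n := [set y | enorm (y - x) <= r].

Lemma closed_closed_eball x r : closed (closed_eball x r).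
Proof.
apply: (@closed_comp _ _ (fun y => enorm (y - x)) [set s | s <= r]); last exact: closed_le.
by move=> y _; exact: continuous_enormB.
Qed.

Lemma compact_closed_eball x r : compact (closed_eball x r).
Proof.
apply: bounded_closed_compact; last exact: closed_closed_eball.
exists (r + `|x|); split; first exact: num_real.
move=> M /ltW rM y yr; apply: le_trans rM.
rewrite -[y](subrK x) (le_trans (ler_normD _ _))// lerD2r.
exact: le_trans (norm_le_enorm _) yr.
Qed.

Lemma eball_sub_closed_eball x r : eball x r `<=` closed_eball x r.
Proof. by move=> y /ltW. Qed.

Lemma compact_closure_eball x r : compact (closure (eball x r)).
Proof.
apply: (subclosed_compact _ (@compact_closed_eball x r)); first exact: closed_closure.
rewrite [X in _ `<=` X](closure_id _).1; last exact: closed_closed_eball.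
exact: closureS (@eball_sub_closed_eball _ _).
Qed.

Lemma bounded_set_sub_eball x (A : set 'rV[R]_n) :
  bounded_set A -> exists2 r, 0 < r & A `<=` eball x r.
Proof.
move=> [K [_ AK]]; pose L := `|K| + 1 + `|x|.
have L0 : 0 <= L by rewrite !addr_ge0.
exists (Num.sqrt n%:R * L + 1); first by rewrite ltr_wpDl// mulr_ge0// sqrtr_ge0.
move=> y Ay; rewrite /eball/= (le_lt_trans (enorm_le_norm _))// ltr_pwDr//.
apply: ler_wpM2l; first exact: sqrtr_ge0.
rewrite (le_trans (ler_normB _ _))// lerD2r; apply: (AK (`|K| + 1)) => //.
by rewrite ltr_pwDr// ler_norm.
Qed.

End euclidean_norm.

Lemma compact_continuous_bounded {R : realType} {T : topologicalType} (K : set T)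
    (f : T -> R) : compact K -> (forall y, K y -> {for y, continuous f}) ->
  exists M, forall y, K y -> `|f y| <= M.
Proof.
move=> cK cf.
have : compact (f @` K).
  by apply: continuous_compact cK; apply: continuous_in_subspaceT => y; rewrite inE; exact: cf.
move=> /compact_bounded[M [_ fM]]; exists (M + 1) => y Ky.
by apply: (fM (M + 1)); [rewrite ltrDl|exists y].
Qed.

Section boxes.
Context {R : realType} {n : nat}.

Definition tbox (A : 'I_n -> set R) : set (n.-tuple R) := [set t | forall i, A i (tnth t i)].

Lemma measurable_tbox (A : 'I_n -> set R) :
  (forall i, measurable (A i)) -> measurable (tbox A).
Proof.
move=> mA.
have -> : tbox A = \bigcap_(i in [set: 'I_n]) ((@tnth n R ^~ i) @^-1` A i).
  by apply/seteqP; split => [t At i _|t At i]; [exact: At|exact: (At i I)].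
apply: fin_bigcap_measurable; first exact: finite_finset.
by move=> i _; rewrite -[X in measurable X]setTI; exact: measurable_tnth.
Qed.

Lemma measurable_tuple_tbox :
  @measurable _ (n.-tuple R) =
  <<s [set tbox A | A in [set A : 'I_n -> set R | forall i, measurable (A i)]] >>.
Proof.
apply/seteqP; split.
  apply: smallest_sub; first exact: smallest_sigma_algebra.
  move=> X; rewrite -bigcup_seq => -[i /= _ [B mB <-]].
  apply: sub_sigma_algebra; exists (fun j => if j == i then B else setT).
    by move=> j; case: ifP.
  rewrite setTI; apply/seteqP; split => t /=.
    by move=> /(_ i); rewrite eqxx.
  by move=> Bt j; case: ifPn => [/eqP ->|].
apply: smallest_sub; first exact: sigma_algebra_measurable.
by move=> _ [A mA <-]; exact: measurable_tbox.
Qed.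

Lemma preimage_row_of_ball (x : 'rV[R]_n) (e : R) : 0 < e ->
  row_of @^-1` ball x e = tbox (fun i => ball (x ord0 i) e).
Proof.
move=> e0; apply/seteqP; split => t; first by move=> [_ xt] i; have := xt ord0 i; rewrite mxE.
by move=> xt; split=> // i j; rewrite (ord1 i) mxE; exact: xt.
Qed.

Lemma near_rat_row (x : 'rV[R]_n) (e : R) : 0 < e ->
  exists q : n.-tuple rat, ball x e (row_of [tuple ratr (tnth q i) | i < n]).
Proof.
move=> e0.
have near_rat i : exists q : rat, ball (x ord0 i) e (ratr q).
  have [q] : exists q, ratr q \in `](x ord0 i - e), (x ord0 i + e)[.
    by apply: rat_in_itvoo; rewrite ltrBlDr -addrA ltrDl addr_gt0.
  by rewrite in_itv/= => xq; exists q; rewrite /ball/= ltr_distlC.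
have [q xq] := choice near_rat.
exists [tuple q i | i < n]; split=> // i j; rewrite (ord1 i) mxE !tnth_mktuple.
exact: xq.
Qed.

Lemma measurable_preimage_row_of (A : set 'rV[R]_n) : open A -> measurable (row_of @^-1` A).
Proof.
move=> oA.
pose B (p : n.-tuple rat * nat) : set 'rV[R]_n :=
  ball (row_of [tuple ratr (tnth p.1 i) | i < n]) p.2.+1%:R^-1.
pose inner := {p | `[< B p `<=` A >]}.
have -> : A = \bigcup_(p : inner) B (val p).
  apply/seteqP; split => [x Ax|x [[p /= /asboolP pA] _]]; last exact: pA.
  have /nbhs_ballP[e /= e0 eA] : nbhs x A by exact: open_nbhs_nbhs.
  have [k ke] : exists k : nat, k.+1%:R^-1 < e / 2 :> R.
    exists (Num.truncn (e / 2)^-1); rewrite invf_plt ?posrE ?divr_gt0//.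
    exact: truncnS_gt.
  have k0 : 0 < k.+1%:R^-1 :> R by rewrite invr_gt0.
  have [q xq] := near_rat_row x k0.
  have qA : `[< B (q, k) `<=` A >].
    apply/asboolP => y qy; apply: eA.
    apply: (@ball_splitr _ _ (row_of [tuple ratr (tnth q i) | i < n])).
      by apply: le_ball (ball_sym xq); exact: ltW.
    by apply: le_ball qy; exact: ltW.
  by exists (exist _ (q, k) qA) => //; exact: ball_sym.
rewrite preimage_bigcup; apply: countable_bigcupT_measurable; first exact: countableP.
move=> p; rewrite preimage_row_of_ball ?invr_gt0//; apply: measurable_tbox => i.
by apply: open_measurable; exact: ball_open.
Qed.

Lemma measurable_fun_row_of (A : set 'rV[R]_n) (f : 'rV[R]_n -> R) :
  open A -> (forall x, A x -> {for x, continuous f}) ->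
  measurable_fun (row_of @^-1` A) (f \o row_of).
Proof.
move=> oA cf; apply: (measurability _ (RGenOpens.measurableE R)).
move=> _ [_ [a [b ->]] <-].
apply: (@measurable_preimage_row_of (A `&` f @^-1` `]a, b[)).
rewrite openE => x [Ax fx]; apply: filterI; first exact: open_nbhs_nbhs.
by apply: (cf _ Ax); apply: open_nbhs_nbhs; split => //; exact: interval_open.
Qed.

Lemma measurable_fun_enormB (x : 'rV[R]_n) :
  measurable_fun setT (fun t : n.-tuple R => enorm (row_of t - x)).
Proof.
apply: (@measurable_fun_row_of setT (fun y => enorm (y - x))); first exact: openT.
by move=> y _; exact: continuous_enormB.
Qed.

End boxes.

Definition pushforward_measure d d' (T : measurableType d) (T' : measurableType d')
    (R : realType) (mu : {measure set T -> \bar R}) (f : T -> T')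
    (mf : measurable_fun setT f) : {measure set T' -> \bar R} :=
  measure_function_pushforward__canonical__measure_function_Measure mu mf.

Section lebn_theory.
Context {R : realType}.
Local Notation lam := (@lebesgue_measure R).

Definition tinsert n (i : 'I_n.+1) (p : (n.-tuple R * measurableTypeR R)%type) : n.+1.-tuple R :=
  [tuple if unlift i j is Some k then tnth p.1 k else p.2 | j < n.+1].

Lemma tcons_tinsert n : @tcons R n = tinsert ord0.
Proof.
apply/funext => -[t s]; apply/eq_from_tnth => j; rewrite tnth_mktuple.
by case: (unliftP ord0 j) => [k ->|->]; rewrite ?tnthS ?tnth0.
Qed.

Lemma measurable_tinsert n i : measurable_fun setT (@tinsert n i).
Proof.
apply/measurable_fun_tnthP => j /=; rewrite /comp.
under eq_fun do rewrite tnth_mktuple.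
case: (unlift i j) => [k|]; last exact: measurable_snd.
by apply: (measurableT_comp (f := @tnth n R ^~ k)); [exact: measurable_tnth|exact: measurable_fst].
Qed.

Lemma preimage_tinsert_tbox n i (A : 'I_n.+1 -> set R) :
  @tinsert n i @^-1` tbox A = tbox (A \o lift i) `*` A i.
Proof.
apply/seteqP; split => [[t s] /= At|[t s] /= [At As] j].
  split; last by have := At i; rewrite tnth_mktuple unlift_none.
  by move=> j /=; have := At (lift i j); rewrite tnth_mktuple liftK.
by rewrite tnth_mktuple; case: (unliftP i j) => [k ->|->] //; exact: At.
Qed.

Lemma lebn_tbox n (A : 'I_n -> set R) : (forall i, measurable (A i)) ->
  lebn n (tbox A) = (\prod_(i < n) lam (A i))%E.
Proof.
elim: n A => [|n ih] A mA; first by rewrite big_ord0 /= diracE mem_set// => -[].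
rewrite big_ord_recl /= /pushforward tcons_tinsert preimage_tinsert_tbox.
rewrite product_measure1E//; first last.
- exact: mA.
- by apply: measurable_tbox => i; exact: mA.
by rewrite ih 1?muleC// => i; exact: mA.
Qed.

Definition cube n (k : nat) : set (n.-tuple R) := tbox (fun=> `]- (k%:R : R), k%:R[%classic).

Lemma measurable_cube n k : measurable (@cube n k).
Proof. exact: measurable_tbox. Qed.

Lemma lebn_cube_lty n k : (lebn n (@cube n k) < +oo)%E.
Proof.
rewrite lebn_tbox// ltey_eq; apply/orP; left; apply: prode_fin_num => i _ /=.
by rewrite lebesgue_measure_itv/=; case: ifP.
Qed.

Lemma bounded_set_sub_cube n (A : set 'rV[R]_n) :
  bounded_set A -> exists k, row_of @^-1` A `<=` cube k.
Proof.
move=> [K [_ AK]]; exists (Num.truncn (`|K| + 1)).+1 => t At i /=.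
rewrite in_itv/= -ltr_norml; apply: le_lt_trans (truncnS_gt _).
have := norm_coord_le (row_of t) ord0 i; rewrite mxE => /le_trans; apply.
by apply: AK At; rewrite ltr_pwDr// ler_norm.
Qed.

Lemma bigcup_cube n : \bigcup_k @cube n k = setT.
Proof.
apply/seteqP; split => // t _.
have [k] : exists k, row_of @^-1` [set row_of t] `<=` cube k.
  by apply: bounded_set_sub_cube; apply: compact_bounded; exact: compact_set1.
by move=> /(_ t erefl) tk; exists k.
Qed.

Lemma lebn_sub_compact_lty n (A K : set 'rV[R]_n) :
  measurable (row_of @^-1` A) -> compact K -> A `<=` K -> (lebn n (row_of @^-1` A) < +oo)%E.
Proof.
move=> mA /compact_bounded/bounded_set_sub_cube[k Kk] AK.
apply: le_lt_trans (lebn_cube_lty n k).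
by apply: le_measure => [||t /AK/Kk//]; rewrite inE//; exact: measurable_cube.
Qed.

Lemma lebn_unique n (mu : {measure set (n.-tuple R) -> \bar R}) :
  (forall A : 'I_n -> set R, (forall i, measurable (A i)) ->
     mu (tbox A) = (\prod_(i < n) lam (A i))%E) ->
  forall X, measurable X -> lebn n X = mu X.
Proof.
move=> muE X mX; apply: (measure_unique _ (@cube n) measurable_tuple_tbox) => //.
- move=> _ _ [A mA <-] [B mB <-]; exists (fun i => A i `&` B i).
    by move=> i; exact: measurableI.
  apply/seteqP; split => [t /= ABt|t /= [At Bt] i]; last by split.
  by split => i; case: (ABt i).
- by move=> k; eexists; last reflexivity.
- exact: bigcup_cube.
- by move=> _ [A mA <-]; rewrite muE// lebn_tbox.
- exact: lebn_cube_lty.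
Qed.

Lemma lebn_sigma_finite n : sigma_finite setT (lebn n : {measure set (n.-tuple R) -> \bar R}).
Proof.
exists (@cube n); first by rewrite bigcup_cube.
by move=> k; split; [exact: measurable_cube|exact: lebn_cube_lty].
Qed.

(* A convertible copy of [lebn n]: being itself the projection of a packed measure, [lebn n] cannot
   carry an instance of its own. *)
Definition lebesgue_tuple n : set (n.-tuple R) -> \bar R := lebn n.

HB.instance Definition _ n := isMeasure.Build _ _ _ (@lebesgue_tuple n)
  (measure0 (lebn n)) (measure_ge0 (lebn n)) (@measure_semi_sigma_additive _ _ _ (lebn n)).

HB.instance Definition _ n := Measure_isSigmaFinite.Build _ _ _ (@lebesgue_tuple n)
  (@lebn_sigma_finite n).

Definition lebn_insert n (i : 'I_n.+1) : {measure set (n.+1.-tuple R) -> \bar R} :=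
  pushforward_measure (@lebesgue_tuple n \x lam)%E (measurable_tinsert i).

Lemma lebn_insertE n i (X : set (n.+1.-tuple R)) : measurable X -> lebn n.+1 X = lebn_insert i X.
Proof.
apply: lebn_unique => A mA.
rewrite /= /pushforward preimage_tinsert_tbox product_measure1E//; last 2 first.
- by apply: measurable_tbox => j; exact: mA.
- exact: mA.
rewrite /lebesgue_tuple lebn_tbox; last by move=> j; exact: mA.
by rewrite [RHS](bigD1_ord i)//= muleC.
Qed.

Lemma integral_tinsert n (i : 'I_n.+1) (f : n.+1.-tuple R -> \bar R) :
  (lebn n.+1).-integrable setT f ->
  (\int[lebn n.+1]_t f t = \int[@lebesgue_tuple n]_t \int[lam]_s f (tinsert i (t, s)))%E.
Proof.
move=> fi; have mf : measurable_fun setT f by exact: measurable_int fi.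
have insertE (g : n.+1.-tuple R -> \bar R) : (\int[lebn n.+1]_t g t = \int[lebn_insert i]_t g t)%E.
  by apply: eq_measure_integral => A mA _; exact: lebn_insertE.
have fi_prod : (@lebesgue_tuple n \x lam)%E.-integrable setT (f \o tinsert i).
  apply/integrableP; split; first by apply: measurableT_comp => //; exact: measurable_tinsert.
  have /integrableP[_] := fi; rewrite insertE.
  rewrite (ge0_integral_pushforward (measurable_tinsert i))//.
  exact: measurableT_comp.
rewrite insertE [LHS](integral_pushforward (measurable_tinsert i))//.
by rewrite preimage_setT -(integral12_prod_meas1 fi_prod).
Qed.

Definition taffine n (c : 'rV[R]_n) (a : R) (t : n.-tuple R) : n.-tuple R :=
  [tuple c ord0 i + a * tnth t i | i < n].

Lemma row_of_taffine n (c : 'rV[R]_n) a t : row_of (taffine c a t) = c + a *: row_of t.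
Proof. by apply/rowP => i; rewrite !mxE tnth_mktuple. Qed.

Lemma measurable_affine (c a : R) :
  measurable_fun setT (fun s : measurableTypeR R => c + a * s : measurableTypeR R).
Proof. by apply: measurable_funD => //; apply: measurable_funM. Qed.

Lemma measurable_taffine n (c : 'rV[R]_n) a : measurable_fun setT (taffine c a).
Proof.
apply/measurable_fun_tnthP => j /=; rewrite /comp; under eq_fun do rewrite tnth_mktuple.
by apply: (measurableT_comp (measurable_affine (c ord0 j) a)); exact: measurable_tnth.
Qed.

Lemma lebesgue_measure_affine (c a : R) (A : set R) : 0 < a -> measurable A ->
  lam A = (a%:E * lam ((fun s => c + a * s)%R @^-1` A))%E.
Proof.
move=> a0; have a_ge0 : 0 <= a by exact: ltW.
apply: (@lebesgue_measure_unique R [the measure _ _ of mscale (NngNum a_ge0)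
  (pushforward_measure lam (measurable_affine c a))]) => _ [[x y] _ <-].
rewrite /= /mscale/= /pushforward.
have -> : (fun s : R => c + a * s) @^-1` `]x, y] = `](x - c) / a, (y - c) / a]%classic.
  by apply/seteqP; split => s /=; rewrite !in_itv/= ltr_pdivrMr// ler_pdivlMr//;
    move=> /andP[xs sy]; apply/andP; split; lra.
rewrite !lebesgue_measure_itv/= !lte_fin ltr_pM2r ?invr_gt0// ltrD2r.
case: ifPn => // _; last by rewrite mule0.
rewrite -!EFinD -EFinM; congr EFin; field; exact: lt0r_neq0.
Qed.

Lemma preimage_taffine_tbox n (c : 'rV[R]_n) a (A : 'I_n -> set R) :
  taffine c a @^-1` tbox A = tbox (fun i => (fun s => c ord0 i + a * s) @^-1` A i).
Proof. by apply/seteqP; split => t /= At i; have := At i; rewrite tnth_mktuple. Qed.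

Lemma lebn_affine n (c : 'rV[R]_n) (a : R) (X : set (n.-tuple R)) : 0 < a ->
  measurable X -> lebn n X = ((a ^+ n)%:E * lebn n (taffine c a @^-1` X))%E.
Proof.
move=> a0; have an_ge0 : 0 <= a ^+ n by rewrite exprn_ge0// ltW.
apply: (@lebn_unique _ [the measure _ _ of mscale (NngNum an_ge0)
  (pushforward_measure (lebn n) (measurable_taffine c a))]) => A mA.
rewrite /= /mscale/= /pushforward preimage_taffine_tbox lebn_tbox; last first.
  by move=> i; have := measurable_affine (c ord0 i) a measurableT (mA i); rewrite setTI.
apply/esym; transitivity (\prod_(i < n) (a%:E * lam ((fun s => c ord0 i + a * s)%R @^-1` A i)))%E.
  by apply: eq_bigr => i _; exact: lebesgue_measure_affine.
by rewrite big_split/= prodEFin big_const_ord iter_mulr_1.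
Qed.

End lebn_theory.

Arguments lebesgue_tuple {R} n X.

Section balls.
Context {R : realType}.

Lemma lebn_ball n (x : 'rV[R]_n) (e : R) : 0 < e ->
  lebn n (row_of @^-1` ball x e) = ((e *+ 2) ^+ n)%:E.
Proof.
move=> e0; rewrite preimage_row_of_ball// lebn_tbox; last first.
  by move=> i; apply: open_measurable; exact: ball_open.
under eq_bigr do rewrite lebesgue_measure_ball ?ltW//.
by rewrite prodEFin big_const_ord iter_mulr_1.
Qed.

Lemma lebn_open_gt0 n (A : set 'rV[R]_n) (x : 'rV[R]_n) :
  open A -> A x -> (0 < lebn n (row_of @^-1` A))%E.
Proof.
move=> oA Ax; have /nbhs_ballP[e /= e0 eA] : nbhs x A by exact: open_nbhs_nbhs.
apply: (@lt_le_trans _ _ (lebn n (row_of @^-1` ball x e))).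
  by rewrite lebn_ball// lte_fin exprn_gt0// mulrn_wgt0.
apply: le_measure; rewrite ?inE; last by move=> t /eA.
- by apply: measurable_preimage_row_of; exact: ball_open.
- exact: measurable_preimage_row_of.
Qed.

Lemma preimage_row_of_set1 n (x : 'rV[R]_n) :
  row_of @^-1` [set x] = tbox (fun i => [set x ord0 i]).
Proof.
apply/seteqP; split => [t <- i|t tx]; first by rewrite mxE.
by apply/rowP => i; rewrite mxE; exact: tx.
Qed.

Lemma measurable_preimage_row_of_set1 n (x : 'rV[R]_n) : measurable (row_of @^-1` [set x]).
Proof. by rewrite preimage_row_of_set1; exact: measurable_tbox. Qed.

Lemma lebn_set1 n (x : 'rV[R]_n.+1) : lebn n.+1 (row_of @^-1` [set x]) = 0%E.
Proof. by rewrite preimage_row_of_set1 lebn_tbox// big_ord_recl lebesgue_measure_set1 mul0e. Qed.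

Lemma measurable_eball n (x : 'rV[R]_n) r : measurable (row_of @^-1` eball x r).
Proof. by apply: measurable_preimage_row_of; exact: open_eball. Qed.

Lemma lebn_eball_lty n (x : 'rV[R]_n) r : (lebn n (row_of @^-1` eball x r) < +oo)%E.
Proof.
exact: lebn_sub_compact_lty (measurable_eball x r) (@compact_closed_eball _ _ x r)
  (@eball_sub_closed_eball _ _ x r).
Qed.

Lemma ball_vol_gt0 n r : 0 < r -> 0 < ball_vol n (r : R).
Proof.
move=> r0; apply: fine_gt0; rewrite lebn_eball_lty andbT.
apply: (@lebn_open_gt0 _ _ 0); first exact: open_eball.
exact: eball_center.
Qed.

Lemma preimage_taffine_eball n (x : 'rV[R]_n) (a : R) : 0 < a ->
  taffine x a @^-1` (row_of @^-1` eball x a) = row_of @^-1` eball 0 1.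
Proof.
move=> a0; apply/seteqP; split => t; rewrite /= /eball /= row_of_taffine addrAC subrr add0r subr0;
  by rewrite enormZ gtr0_norm// -ltr_pdivlMl// mulVf// gt_eqF.
Qed.

Lemma lebn_eball_scale n (x : 'rV[R]_n) r : 0 < r ->
  lebn n (row_of @^-1` eball x r) = (r ^+ n * ball_vol n (1 : R))%:E.
Proof.
move=> r0; rewrite (@lebn_affine _ _ x r)//; last exact: measurable_eball.
by rewrite preimage_taffine_eball// EFinM fineK// ge0_fin_numE// lebn_eball_lty.
Qed.

Lemma ball_volE n r : 0 < r -> ball_vol n r = r ^+ n * ball_vol n (1 : R).
Proof. by move=> r0; rewrite {1}/ball_vol lebn_eball_scale. Qed.

Lemma lebn_eball n (x : 'rV[R]_n) r : 0 < r ->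
  lebn n (row_of @^-1` eball x r) = (ball_vol n r)%:E.
Proof. by move=> r0; rewrite lebn_eball_scale// -ball_volE. Qed.

Lemma integrable_continuous_row_of n (A K : set 'rV[R]_n) (f : 'rV[R]_n -> R) :
  open A -> compact K -> A `<=` K -> (forall y, K y -> {for y, continuous f}) ->
  (lebn n).-integrable (row_of @^-1` A) (EFin \o (f \o row_of)).
Proof.
move=> oA cK AK cf; have mA := measurable_preimage_row_of oA.
have [M fM] := compact_continuous_bounded cK cf.
apply: measurable_bounded_integrable => //.
- exact: lebn_sub_compact_lty mA cK AK.
- by apply: measurable_fun_row_of => // y /AK; exact: cf.
exists M; split; first exact: num_real.
by move=> N /ltW MN t /AK /fM /le_trans; exact.
Qed.

Lemma integrable_continuous_eball n (x : 'rV[R]_n) r (f : 'rV[R]_n -> R) :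
  (forall y, closed_eball x r y -> {for y, continuous f}) ->
  (lebn n).-integrable (row_of @^-1` eball x r) (EFin \o (f \o row_of)).
Proof.
exact: integrable_continuous_row_of (@open_eball _ _ x r) (@compact_closed_eball _ _ x r)
  (@eball_sub_closed_eball _ _ x r).
Qed.

Lemma Rintegral_eball_dist n (x : 'rV[R]_n) (r a e : R) (f : n.-tuple R -> R) : 0 < r ->
  (lebn n).-integrable (row_of @^-1` eball x r) (EFin \o f) ->
  (forall t, eball x r (row_of t) -> `|f t - a| <= e) ->
  `|\int[lebn n]_(t in row_of @^-1` eball x r) f t - ball_vol n r * a| <= ball_vol n r * e.
Proof.
move=> r0 intf fe; have mB := measurable_eball x r.
have int_cst k : (lebn n).-integrable (row_of @^-1` eball x r) (EFin \o cst k).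
  by apply: (@integrable_continuous_eball _ _ _ (cst k)) => y _; exact: cst_continuous.
have cstE k : ball_vol n r * k = \int[lebn n]_(t in row_of @^-1` eball x r) k.
  by rewrite Rintegral_cst// lebn_eball// mulrC.
rewrite !cstE -RintegralB//; last exact: int_cst.
have intB : (lebn n).-integrable (row_of @^-1` eball x r) (EFin \o (fun t => f t - a)).
  by have := integrableB mB intf (int_cst a); apply: eq_integrable => // t _; rewrite /= EFinB.
apply: (le_trans (le_normr_Rintegral mB intB)); apply: le_Rintegral => //.
  exact: integrable_norm intB.
exact: int_cst.
Qed.

End balls.

Lemma FTC2_itvoo {R : realType} (F f : R -> R) (a b : R) : a < b ->
  (forall s, a <= s <= b -> is_derive s 1 F (f s)) ->
  (forall s, a <= s <= b -> {for s, continuous f}) ->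
  (\int[lebesgue_measure]_(s in `]a, b[) (f s)%:E = (F b - F a)%:E)%E.
Proof.
move=> ab dF cf.
have cfab : {within `[a, b], continuous f}.
  by apply: continuous_in_subspaceT => s; rewrite inE /= in_itv/= => /cf.
have dF_itvcc : {in `[a, b], forall s, derivable F s 1}.
  by move=> s; rewrite in_itv/= => /dF dFs; exact: ex_derive.
rewrite -(integral_itv_bndoo true false); last first.
  apply/measurable_EFinP; apply: measurable_funS (subspace_continuous_measurable_fun _ cfab) => //.
  exact: subset_itv_oo_cc.
rewrite EFinB; apply: continuous_FTC2 => //.
- have /(continuous_within_itvP _ ab)[_ Fa Fb] := derivable_within_continuous dF_itvcc.
  by split => // s /subset_itv_oo_cc; exact: dF_itvcc.
- move=> s /subset_itv_oo_cc; rewrite in_itv/= => /dF dFs.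
  by rewrite derive1E; exact: derive_val.
Qed.

Lemma is_derive_line {R : realType} {V W : normedModType R} (f : V -> W) (y v : V) (s : R)
    (df : W) :
  is_derive (y + s *: v) v f df -> is_derive s 1 (fun s => f (y + s *: v)) df.
Proof.
move=> [f_derivable dfE].
have lineE : (fun h : R => h^-1 *: (f (y + (h *: (1 : R) + s) *: v) - f (y + s *: v))) =
   (fun h : R => h^-1 *: (f (h *: v + (y + s *: v)) - f (y + s *: v))).
  apply/funext => h; congr (_ *: (f _ - _)).
  by rewrite -[h *: 1]/(h * 1) mulr1 scalerDl addrCA.
by apply: DeriveDef; rewrite /derivable /derive /shift /= lineE.
Qed.

Section divergence_on_balls.
Context {R : realType} {n : nat}.
Local Notation lam := (@lebesgue_measure R).
Implicit Types (x y : 'rV[R]_n.+1) (t : n.-tuple R) (g : 'rV[R]_n.+1 -> R).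

Lemma row_of_tinsert (i : 'I_n.+1) t (s : R) :
  row_of (tinsert i (t, s)) = row_of (tinsert i (t, 0)) + s *: delta_mx ord0 i.
Proof.
apply/rowP => j; rewrite !mxE !tnth_mktuple /=.
case: (unliftP i j) => [k ->|->]; rewrite ?eqxx ?mulr1 ?add0r//.
by rewrite eq_sym (negbTE (neq_lift _ _)) mulr0 addr0.
Qed.

Lemma enorm_tinsert_sqr (i : 'I_n.+1) t (s : R) x :
  enorm (row_of (tinsert i (t, s)) - x) ^+ 2 =
  enorm (row_of t - col' i x) ^+ 2 + (s - x ord0 i) ^+ 2.
Proof.
rewrite !enorm_sqr (bigD1_ord i)//= addrC !mxE tnth_mktuple unlift_none; congr (_ + _).
by apply: eq_bigr => k _; rewrite !mxE tnth_mktuple liftK.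
Qed.

(* It is 0 when the line through [t] parallel to the i-th axis misses the ball, since [Num.sqrt]
   vanishes on negative numbers. *)
Definition half_chord (i : 'I_n.+1) x (r : R) t : R :=
  Num.sqrt (r ^+ 2 - enorm (row_of t - col' i x) ^+ 2).

Lemma eball_tinsert (i : 'I_n.+1) x (r : R) t s : 0 < r ->
  eball x r (row_of (tinsert i (t, s))) = (`|s - x ord0 i| < half_chord i x r t) :> Prop.
Proof.
move=> r0; rewrite /eball/= -(ltr_pXn2r (n := 2)) ?nnegrE ?enorm_ge0 ?ltW// enorm_tinsert_sqr.
rewrite -ltrBrDl /half_chord -sqrtr_sqr.
have [chord0|chord0] := ltP 0 (r ^+ 2 - enorm (row_of t - col' i x) ^+ 2).
  by rewrite ltr_sqrt.
by rewrite (ler0_sqrtr chord0) !ltNge sqrtr_ge0 (le_trans chord0) ?sqr_ge0.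
Qed.

Lemma enorm_tinsert_chord (i : 'I_n.+1) x (r : R) t s : 0 < half_chord i x r t ->
  enorm (row_of (tinsert i (t, s)) - x) ^+ 2 =
  r ^+ 2 + (`|s - x ord0 i| ^+ 2 - half_chord i x r t ^+ 2).
Proof.
rewrite sqrtr_gt0 => chord0.
by rewrite enorm_tinsert_sqr real_normK ?num_real// [half_chord _ _ _ _ ^+ 2]sqr_sqrtr ?ltW//; ring.
Qed.

Lemma integral_chord_partial (i : 'I_n.+1) x (r : R) g (dg : 'rV[R]_n.+1 -> R) t : 0 < r ->
  (forall y, closed_eball x r y -> is_derive y (delta_mx ord0 i) g (dg y)) ->
  (forall y, closed_eball x r y -> {for y, continuous dg}) ->
  (forall y, enorm (y - x) = r -> g y = 0) ->
  (\int[lam]_s ((EFin \o (dg \o row_of)) \_ (row_of @^-1` eball x r)) (tinsert i (t, s)) = 0)%E.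
Proof.
move=> r0 dgE cdg g0.
pose line s : 'rV[R]_n.+1 := row_of (tinsert i (t, 0)) + s *: delta_mx ord0 i.
have lineE s : row_of (tinsert i (t, s)) = line s by exact: row_of_tinsert.
pose c := x ord0 i; pose h := half_chord i x r t.
transitivity (\int[lam]_(s in `](c - h)%R, (c + h)%R[) (dg (line s))%:E)%E.
  rewrite [RHS]integral_mkcond; apply: eq_integral => s _.
  rewrite !patchE /= lineE; congr (if _ then _ else _).
  by apply: asbool_equiv_eq; rewrite /= eball_tinsert// in_itv/= -ltr_distl.
have : 0 <= h by exact: sqrtr_ge0.
rewrite le_eqVlt => /predU1P[<-|h0]; first by rewrite subr0 addr0 set_itvoo0 integral_set0.
have line_sqr s : enorm (line s - x) ^+ 2 = r ^+ 2 + (`|s - c| ^+ 2 - h ^+ 2).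
  by rewrite -lineE (@enorm_tinsert_chord _ _ r).
have line_in s : c - h <= s <= c + h -> closed_eball x r (line s).
  rewrite -ler_distl /closed_eball/= => sh; rewrite -ler_sqr ?nnegrE ?enorm_ge0 ?(ltW r0)//.
  by rewrite line_sqr gerDl subr_le0 ler_sqr// nnegrE ltW.
have line_end s : `|s - c| = h -> g (line s) = 0.
  move=> sh; apply: g0; apply/eqP; rewrite -(eqrXn2 (n := 2)) ?enorm_ge0 ?(ltW r0)//.
  by rewrite line_sqr sh subrr addr0.
have -> : (0 = ((g \o line) (c + h) - (g \o line) (c - h))%:E)%E.
  by rewrite /= !line_end ?subrr// addrAC subrr add0r ?normrN gtr0_norm.
apply: FTC2_itvoo.
- by rewrite ltrD2l gtrN.
- by move=> s /line_in/dgE; exact: is_derive_line.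
move=> s /line_in/cdg; apply: continuous_comp.
by apply: continuousD; [exact: cst_continuous|exact: scalel_continuous].
Qed.

Lemma integral_partial_eq0 (i : 'I_n.+1) x (r : R) g (dg : 'rV[R]_n.+1 -> R) : 0 < r ->
  (forall y, closed_eball x r y -> is_derive y (delta_mx ord0 i) g (dg y)) ->
  (forall y, closed_eball x r y -> {for y, continuous dg}) ->
  (forall y, enorm (y - x) = r -> g y = 0) ->
  (\int[lebn n.+1]_(t in row_of @^-1` eball x r) (dg (row_of t))%:E = 0)%E.
Proof.
move=> r0 dgE cdg g0; rewrite integral_mkcond (@integral_tinsert _ _ i).
  by rewrite integral0_eq// => t _; exact: integral_chord_partial.
apply/(integrable_mkcond _ (measurable_eball x r)).
exact: integrable_continuous_eball.
Qed.

Lemma integral_divergence_eq0 x (r : R) (g dg : 'I_n.+1 -> 'rV[R]_n.+1 -> R) : 0 < r ->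
  (forall i y, closed_eball x r y -> is_derive y (delta_mx ord0 i) (g i) (dg i y)) ->
  (forall i y, closed_eball x r y -> {for y, continuous (dg i)}) ->
  (forall i y, enorm (y - x) = r -> g i y = 0) ->
  \int[lebn n.+1]_(t in row_of @^-1` eball x r) (\sum_i dg i (row_of t)) = 0.
Proof.
move=> r0 dgE cdg g0; rewrite /Rintegral; under eq_integral do rewrite -sumEFin.
rewrite integral_sum; last 2 first.
- exact: measurable_eball.
- by move=> i; exact: integrable_continuous_eball (cdg i).
by rewrite big1// => i _; exact: integral_partial_eq0 (dgE i) (cdg i) (g0 i).
Qed.

End divergence_on_balls.

Section integrals_over_sections.
Context d1 d2 (T1 : measurableType d1) (T2 : measurableType d2) (R : realType).
Variable (m1 : {sigma_finite_measure set T1 -> \bar R}).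
Variable (m2 : {sigma_finite_measure set T2 -> \bar R}).
Variables (Q : set (T1 * T2)) (f : T1 * T2 -> \bar R).
Hypothesis mQ : measurable Q.
Local Open Scope ereal_scope.

Lemma integral_xsection (g : T1 * T2 -> \bar R) x :
  \int[m2]_y (g \_ Q) (x, y) = \int[m2]_(y in xsection Q x) g (x, y).
Proof.
rewrite [RHS]integral_mkcond; apply: eq_integral => y _.
by rewrite !patchE mem_xsection.
Qed.

Lemma integral_ysection (g : T1 * T2 -> \bar R) y :
  \int[m1]_x (g \_ Q) (x, y) = \int[m1]_(x in ysection Q y) g (x, y).
Proof.
rewrite [RHS]integral_mkcond; apply: eq_integral => x _.
by rewrite !patchE mem_ysection.
Qed.

Lemma measurable_integral_ysection (g : T1 * T2 -> \bar R) :
  measurable_fun Q g -> (forall xy, 0 <= g xy) ->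
  measurable_fun setT (fun y => \int[m1]_(x in ysection Q y) g (x, y)).
Proof.
move=> mg g0; under eq_fun do rewrite -integral_ysection.
apply: (@measurable_fun_fubini_tonelli_G _ _ _ _ _ m1 (g \_ Q)).
  exact/(measurable_restrictT _ mQ).
by move=> xy; apply: erestrict_ge0 => xy' _; exact: g0.
Qed.

Lemma integral_abse_ysection y :
  \int[m1]_(x in ysection Q y) `|f (x, y)| = \int[m1]_x `|(f \_ Q) (x, y)|.
Proof.
rewrite -(integral_ysection (abse \o f)); apply: eq_integral => x _.
by rewrite -[RHS]/((abse \o (f \_ Q)) (x, y)) -restrict_abse.
Qed.

Lemma integrable_ysectionP : measurable_fun Q f ->
  (m1 \x m2).-integrable Q f <-> \int[m2]_y \int[m1]_(x in ysection Q y) `|f (x, y)| < +oo.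
Proof.
move=> mf; under eq_integral do rewrite integral_abse_ysection.
apply: iff_trans (integrable_mkcond _ mQ) (integrable21ltyP _ _ _).
exact/(measurable_restrictT _ mQ).
Qed.

Hypothesis intf : (m1 \x m2).-integrable Q f.

Let intfQ : (m1 \x m2).-integrable setT (f \_ Q).
Proof. exact/(integrable_mkcond _ mQ). Qed.

Lemma integrable_integral_xsection :
  m1.-integrable setT (fun x => \int[m2]_(y in xsection Q x) f (x, y)).
Proof.
apply: eq_integrable (integrable_fubini_F intfQ) => // x _.
exact: integral_xsection.
Qed.

Lemma integrable_integral_ysection :
  m2.-integrable setT (fun y => \int[m1]_(x in ysection Q y) f (x, y)).
Proof.
have mf := measurable_int _ intf; have mfQ := measurable_int _ intfQ.
have mG : measurable_fun setT (fun y => \int[m1]_(x in ysection Q y) f (x, y)).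
  by under eq_fun do rewrite -integral_ysection; exact: (measurable_fubini_G intfQ).
apply/integrableP; split => //; apply: le_lt_trans ((integrable_ysectionP mf).1 intf).
apply: ge0_le_integral => //; first exact: measurableT_comp.
  apply: (@measurable_integral_ysection (abse \o f)); first exact: measurableT_comp.
  by move=> xy; exact: abse_ge0.
move=> y _; rewrite -integral_ysection integral_abse_ysection.
by apply: le_abse_integral => //; exact: measurableT_comp.
Qed.

Lemma Fubini_section :
  \int[m1]_x \int[m2]_(y in xsection Q x) f (x, y) =
  \int[m2]_y \int[m1]_(x in ysection Q y) f (x, y).
Proof.
under eq_integral do rewrite -integral_xsection.
by under [RHS]eq_integral do rewrite -integral_ysection; exact: Fubini.
Qed.

End integrals_over_sections.

Section powers.
Context {R : realType}.
Local Notation lam := (@lebesgue_measure R).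

Lemma continuous_powR (p s : R) : 0 < s -> {for s, continuous (@powR R ^~ p)}.
Proof.
move=> s0; apply: differentiable_continuous; apply/derivable1_diffP.
by apply: derivable_powR; rewrite in_itv/= s0.
Qed.

Lemma continuousZ_powR (k p s : R) : 0 < s -> {for s, continuous (fun s : R => k * s `^ p)}.
Proof. by move=> s0; apply: continuousM; [exact: cst_continuous|exact: continuous_powR]. Qed.

Lemma integrable_powR_itvoo (p a b : R) : 0 < a ->
  lam.-integrable `]a, b[ (fun s => (p * s `^ (p - 1))%:E).
Proof.
move=> a0; apply: (@integrableS _ _ _ lam (`[a, b]%classic : set (measurableTypeR R))) => //.
  exact: subset_itv_oo_cc.
apply: continuous_compact_integrable; first exact: segment_compact.
apply: continuous_in_subspaceT => s; rewrite inE/= in_itv/= => /andP[/(lt_le_trans a0) s0 _].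
exact: continuousZ_powR.
Qed.

Lemma integral_powR_itvoo (p a b : R) : 0 < a -> a < b ->
  (\int[lam]_(s in `]a, b[) (p * s `^ (p - 1))%:E = (b `^ p - a `^ p)%:E)%E.
Proof.
move=> a0 ab; apply: (@FTC2_itvoo _ (@powR R ^~ p)) => // s /andP[/(lt_le_trans a0) s0 _].
  exact: is_derive1_powR.
exact: continuousZ_powR.
Qed.

Lemma measurable_scale_powR (k p : R) (A : set R) :
  measurable_fun A (fun s => (k * s `^ p)%:E).
Proof. by apply/measurable_EFinP/measurable_funTS; apply: measurable_funM. Qed.

Lemma integral_powR_itv0o (q r : R) : 0 < q -> 0 < r ->
  (\int[lam]_(s in `]0%R, r[) (q * s `^ (q - 1))%:E = (r `^ q)%:E)%E.
Proof.
move=> q0 r0; pose a (k : nat) := r / k.+2%:R.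
have a0 k : 0 < a k by rewrite divr_gt0.
have ar k : a k < r by rewrite ltr_pdivrMr// ltr_pMr// ltr1n.
have itvE : `]0%R, r[%classic = \bigcup_k `]a k, r[%classic.
  apply/seteqP; split => s /=; last first.
    by move=> [k _] /=; rewrite !in_itv/= => /andP[ks ->]; rewrite (lt_trans _ ks).
  rewrite in_itv/= => /andP[s0 sr]; exists (Num.truncn (r / s)) => //=.
  rewrite in_itv/= sr andbT ltr_pdivrMr// mulrC -ltr_pdivrMr//.
  by apply: lt_trans (truncnS_gt _) _; rewrite ltr_nat.
have int_cvg : (\int[lam]_(s in `]a k, r[) (q * s `^ (q - 1))%:E)%E @[k --> \oo] -->
    (\int[lam]_(s in `]0%R, r[) (q * s `^ (q - 1))%:E)%E.
  rewrite itvE; apply: ge0_nondecreasing_set_cvg_integral => // [k l kl|k|k s _].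
  - apply/subsetPset/subset_itvr; rewrite bnd_simp ler_pM2l// lef_pV2 ?posrE// ler_nat.
    by rewrite !ltnS.
  - exact: measurable_scale_powR.
  - by rewrite lee_fin mulr_ge0 ?powR_ge0// ltW.
apply: cvg_unique int_cvg _ => //.
have -> : (fun k => \int[lam]_(s in `]a k, r[) (q * s `^ (q - 1))%:E)%E =
    (fun k => (r `^ q - a k `^ q)%:E) by apply/funext => k; exact: integral_powR_itvoo.
apply: cvg_EFin; first exact: nearW.
rewrite -[X in _ --> X]subr0; apply: cvgB; first exact: cvg_cst.
have /cvg_at_rightP := powR_cvg0 q0; apply; split => //.
rewrite -[X in _ --> X](mulr0 r); apply: cvgM; first exact: cvg_cst.
have := @cvg_harmonic R; rewrite -cvg_shiftS; exact.
Qed.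

Lemma integrable_powR_itv0o (q r : R) : 0 < q -> 0 < r ->
  lam.-integrable `]0, r[ (fun s => (q * s `^ (q - 1))%:E).
Proof.
move=> q0 r0; apply/integrableP; split.
  exact: measurable_scale_powR.
under eq_integral do rewrite gee0_abs ?lee_fin ?mulr_ge0 ?powR_ge0 ?ltW//.
by rewrite integral_powR_itv0o// ltry.
Qed.

End powers.

Section layer_cake.
Context d (T : measurableType d) (R : realType) (mu : {sigma_finite_measure set T -> \bar R}).
Local Notation lam := (@lebesgue_measure R).
Variables (rho W : T -> R) (r p q C : R).

(* Points with [rho t = 0] are left out because [0 `^ p = 0]: there the layers do not add up to
   [r `^ p - rho t `^ p] when [p < 0]. *)
Local Notation annulus s := [set t | 0 < rho t < s].

Hypotheses (r0 : 0 < r) (pq_gt0 : 0 < p + q).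
Hypothesis mrho : measurable_fun setT rho.
Hypothesis mW : measurable_fun (annulus r) W.
Hypothesis W_growth : forall s, 0 < s < r ->
  (\int[mu]_(t in annulus s) `|W t|%:E <= (C * s `^ q)%:E)%E.

Let layers : set (T * measurableTypeR R) := [set ts | 0 < rho ts.1 /\ rho ts.1 < ts.2 < r].

Let density (ts : T * measurableTypeR R) : R := W ts.1 * (p * ts.2 `^ (p - 1)).

Let measurable_annulus s : measurable (annulus s).
Proof.
rewrite -[X in measurable X]setTI.
have -> : annulus s = rho @^-1` `]0, s[ by apply/seteqP; split => t; rewrite /= in_itv.
exact: mrho.
Qed.

Let measurable_layers : measurable layers.
Proof.
have mrho1 : measurable_fun setT (fun ts : T * measurableTypeR R => rho ts.1).
  exact: measurableT_comp measurable_fst.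
have -> : layers = (fun ts => rho ts.1) @^-1` `]0%R, +oo[ `&`
    ((fun ts => ts.2 - rho ts.1) @^-1` `]0%R, +oo[ `&` snd @^-1` `]-oo, r[).
  apply/seteqP; split => ts; rewrite /layers /= !in_itv/= !andbT subr_gt0.
    by move=> [-> /andP[-> ->]].
  by move=> [-> [-> ->]].
apply: measurableI; last apply: measurableI; rewrite -[X in measurable X]setTI.
- exact: mrho1.
- by apply: measurable_funB => //; exact: measurable_snd.
- exact: (@measurable_snd _ _ T (measurableTypeR R)).
Qed.

Let measurable_density : measurable_fun layers density.
Proof.
apply: measurable_funM.
  apply: (@measurable_comp _ _ _ _ _ _ (annulus r) W _ fst) => //; last exact: measurable_funTS.
  by move=> _ [[t s] [/= t0 /andP[ts sr]] <-] /=; rewrite t0 (lt_trans ts).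
apply: measurable_funTS; apply: measurable_funM => //.
apply: (measurableT_comp (f := fun s : R => s `^ (p - 1))); first exact: measurable_powR.
exact: measurable_snd.
Qed.

Let xsection_layers t : 0 < rho t -> xsection layers t = `]rho t, r[%classic.
Proof.
move=> t0; apply/seteqP; split => s; rewrite /xsection /= inE /= in_itv/=; first by case.
by [].
Qed.

Let xsection_layers0 t : ~ annulus r t -> xsection layers t = set0.
Proof.
move=> tr; apply/seteqP; split => // s; rewrite /xsection /= inE => -[/= t0 /andP[ts sr]].
by apply: tr; rewrite /= t0 (lt_trans ts).
Qed.

Let integral_ysection_layers (h : T * measurableTypeR R -> \bar R) s :
  (\int[mu]_(t in ysection layers s) h (t, s) =
   ((fun s => \int[mu]_(t in annulus s) h (t, s)) \_ `]0%R, r[) s)%E.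
Proof.
rewrite patchE; case: ifPn => [|sr].
  rewrite inE/= in_itv/= => /andP[s0 sr]; congr (integral _ _ _).
  apply/seteqP; split => t; rewrite /ysection /= inE /layers /= sr andbT; last by case/andP.
  by move=> [-> ->].
rewrite [ysection _ _](_ : _ = set0) ?integral_set0//.
apply/seteqP; split => // t; rewrite /ysection /= inE => -[/= t0 /andP[ts s_lt_r]].
by move: sr; rewrite notin_setE; apply; rewrite /= in_itv/= s_lt_r (lt_trans t0).
Qed.

Let powR_shift s : 0 < s -> s `^ (p - 1) * s `^ q = s `^ (p + q - 1).
Proof. by move=> s0; rewrite -powRD ?(gt_eqF s0) ?implybT//; congr (_ `^ _); ring. Qed.

Let integrable_W s : 0 < s < r -> mu.-integrable (annulus s) (EFin \o W).
Proof.
move=> /[dup] /W_growth WC /andP[_ sr]; apply/integrableP; split.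
  apply/measurable_EFinP; apply: measurable_funS mW => // t /= /andP[-> ts].
  exact: lt_trans ts sr.
by apply: le_lt_trans WC _; exact: ltry.
Qed.

Let W_growth_coef_ge0 : 0 <= C.
Proof.
have r2 : 0 < r / 2 < r by rewrite divr_gt0// ltr_pdivrMr// ltr_pMr// ltr1n.
have /andP[r20 _] := r2.
have := le_trans (integral_ge0 _ _) (W_growth r2); rewrite lee_fin pmulr_lge0 ?powR_gt0//.
by apply => t _; rewrite lee_fin.
Qed.

Let integral_abs_density s : 0 < s < r -> (\int[mu]_(t in annulus s) `|(density (t, s))%:E| <=
  (C * `|p| / (p + q))%:E * ((p + q) * s `^ (p + q - 1))%:E)%E.
Proof.
move=> /[dup] sr /andP[s0 _].
have abs_density t : (`|(density (t, s))%:E| = (`|p| * s `^ (p - 1))%:E * `|W t|%:E)%E.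
  by rewrite -EFinM /density/= normrM normrM (ger0_norm (powR_ge0 _ _)) mulrC.
have p_ge0 : 0 <= `|p| * s `^ (p - 1) by rewrite mulr_ge0 ?powR_ge0.
have -> : ((C * `|p| / (p + q))%:E * ((p + q) * s `^ (p + q - 1))%:E =
    (`|p| * s `^ (p - 1))%:E * (C * s `^ q)%:E)%E.
  rewrite -!EFinM -powR_shift//; congr EFin; field; exact: lt0r_neq0.
have [mWs _] := integrableP _ _ _ (integrable_W sr).
under eq_integral do rewrite abs_density; rewrite ge0_integralZl//=.
  by apply: lee_wpmul2l (W_growth sr); rewrite lee_fin.
by apply/measurable_EFinP; apply: measurableT_comp => //; exact/measurable_EFinP.
Qed.

Let integrable_density : (mu \x lam)%E.-integrable layers (EFin \o density).
Proof.
have mdensity : measurable_fun layers (EFin \o density).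
  by apply/measurable_EFinP; exact: measurable_density.
apply/(integrable_ysectionP _ _ measurable_layers mdensity).
have C0 := W_growth_coef_ge0.
pose k := C * `|p| / (p + q); have k0 : 0 <= k by rewrite !mulr_ge0// invr_ge0 ltW.
apply: (@le_lt_trans _ _ (\int[lam]_(s in `]0%R, r[)
    (k%:E * ((p + q) * s `^ (p + q - 1))%:E))%E); last first.
  rewrite ge0_integralZl//; first by rewrite integral_powR_itv0o// ltry.
    exact: measurable_scale_powR.
  by move=> s _; rewrite lee_fin mulr_ge0 ?powR_ge0 ?ltW.
rewrite [leRHS]integral_mkcond; apply: ge0_le_integral => //.
- by move=> s _; exact: integral_ge0.
- apply: (@measurable_integral_ysection _ _ _ _ _ _ _ measurable_layers
    (abse \o (EFin \o density))).
    exact: measurableT_comp.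
  by move=> ts; exact: abse_ge0.
- apply/(measurable_restrictT _ (measurable_itv _)); apply: measurable_funeM.
  exact: measurable_scale_powR.
move=> s _; rewrite (integral_ysection_layers (abse \o (EFin \o density))) !patchE.
by case: ifPn => //; rewrite inE/= in_itv/=; exact: integral_abs_density.
Qed.

Let integral_xsection_layers t :
  (\int[lam]_(s in xsection layers t) (density (t, s))%:E =
   ((fun t => (W t * (r `^ p - rho t `^ p))%:E) \_ (annulus r)) t)%E.
Proof.
rewrite patchE; case: ifPn => [|]; last first.
  by rewrite notin_setE => /xsection_layers0 ->; rewrite integral_set0.
rewrite inE => -/= /andP[t0 tr]; rewrite xsection_layers//.
under eq_integral do rewrite /density /= EFinM.
rewrite integralZl//; first by rewrite integral_powR_itvoo.
exact: integrable_powR_itvoo.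
Qed.

Lemma layer_cake_integrable :
  mu.-integrable (annulus r) (fun t => (W t * (r `^ p - rho t `^ p))%:E).
Proof.
apply/(integrable_mkcond _ (measurable_annulus r)).
by apply: eq_integrable (integrable_integral_xsection measurable_layers integrable_density).
Qed.

Let integral_ysection_density s :
  (\int[mu]_(t in ysection layers s) (density (t, s))%:E =
   ((fun s => (p * s `^ (p - 1) * \int[mu]_(t in annulus s) W t)%:E) \_ `]0%R, r[) s)%E.
Proof.
rewrite (integral_ysection_layers (EFin \o density)) !patchE; case: ifPn => //.
rewrite inE/= in_itv/= => sr; rewrite EFinM /Rintegral fineK; last first.
  exact: integrable_fin_num (integrable_W sr).
rewrite -integralZl//; last exact: integrable_W.
by apply: eq_integral => t _; rewrite -EFinM /density/= mulrC.
Qed.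

Lemma integrable_layers :
  lam.-integrable `]0, r[ (fun s => (p * s `^ (p - 1) * \int[mu]_(t in annulus s) W t)%:E).
Proof.
have m0r : measurable (`]0, r[%classic : set (measurableTypeR R)) by exact: measurable_itv.
apply/(integrable_mkcond _ m0r).
by apply: eq_integrable (integrable_integral_ysection measurable_layers integrable_density).
Qed.

Lemma layer_cake :
  \int[mu]_(t in annulus r) (W t * (r `^ p - rho t `^ p)) =
  \int[lam]_(s in `]0, r[) (p * s `^ (p - 1) * \int[mu]_(t in annulus s) W t).
Proof.
rewrite /Rintegral; congr fine; rewrite integral_mkcond [RHS]integral_mkcond.
rewrite -(eq_integral _ _ (fun t _ => integral_xsection_layers t)).
rewrite -(eq_integral _ _ (fun s _ => integral_ysection_density s)).
exact: (Fubini_section measurable_layers integrable_density).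
Qed.

End layer_cake.

Section layer_cake_on_balls.
Context {R : realType} {n : nat}.
Local Notation lam := (@lebesgue_measure R).
Variables (w : 'rV[R]_n.+1 -> R) (K : set 'rV[R]_n.+1) (x : 'rV[R]_n.+1) (r p : R).
Hypotheses (r0 : 0 < r) (p0 : 0 < p + n.+1%:R).
Hypotheses (compactK : compact K) (xrK : eball x r `<=` K).
Hypothesis cw : forall y, K y -> {for y, continuous w}.

Local Notation rho t := (enorm (row_of t - x)).
Local Notation annulus s := [set t : n.+1.-tuple R | 0 < rho t < s].

Let annulusE s : annulus s = (row_of @^-1` eball x s) `\` (row_of @^-1` [set x]).
Proof.
apply/seteqP; split=> t /=; rewrite lt0r enorm_eq0 subr_eq0 enorm_ge0 andbT.
  by move=> /andP[/eqP tx ts].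
by move=> [ts /eqP tx]; rewrite tx.
Qed.

Let integrable_w s : s <= r ->
  (lebn n.+1).-integrable (row_of @^-1` eball x s) (EFin \o (w \o row_of)).
Proof.
move=> sr; apply: integrable_continuous_row_of compactK _ cw; first exact: open_eball.
exact: subset_trans (sub_eball sr) xrK.
Qed.

Let integral_annulus (f : n.+1.-tuple R -> R) s :
  (lebn n.+1).-integrable (row_of @^-1` eball x s) (EFin \o f) ->
  \int[lebn n.+1]_(t in row_of @^-1` eball x s) f t = \int[lebn n.+1]_(t in annulus s) f t.
Proof.
move=> fi; rewrite /Rintegral annulusE; congr fine.
apply: negligible_integral fi (lebn_set1 x); last exact: measurable_eball.
exact: measurable_preimage_row_of_set1.
Qed.

Let w_growth : exists C, forall s, 0 < s < r ->
  (\int[lebesgue_tuple n.+1]_(t in annulus s) `|(w \o row_of) t|%:E <= (C * s `^ n.+1%:R)%:E)%E.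
Proof.
have [M wM] := compact_continuous_bounded compactK cw.
have M0 : 0 <= M by apply: le_trans (wM x (xrK (eball_center x r0))).
exists (M * ball_vol n.+1 (1 : R)) => s /andP[s0 sr].
have [mws _] := integrableP _ _ _ (integrable_w (ltW sr)).
rewrite annulusE -ge0_negligible_integral//; last 4 first.
- exact: measurable_preimage_row_of_set1.
- exact: measurable_eball.
- by apply/measurable_EFinP; apply: measurableT_comp => //; exact/measurable_EFinP.
- exact: lebn_set1.
apply: (@le_trans _ _ (M%:E * lebn n.+1 (row_of @^-1` eball x s))%E).
  apply: (integral_le_bound (f := EFin \o (w \o row_of))) => //; first exact: measurable_eball.
  by apply: aeW => t ts; rewrite lee_fin; apply: wM; apply: xrK; exact: sub_eball (ltW sr) _ ts.
by rewrite lebn_eball_scale// -EFinM lee_fin -powR_mulrn ?(ltW s0)// -mulrA [X in _ <= M * X]mulrC.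
Qed.

Let measurable_w : measurable_fun (row_of @^-1` eball x r) (w \o row_of).
Proof. by have [/measurable_EFinP] := integrableP _ _ _ (integrable_w (lexx r)). Qed.

Let measurable_w_annulus : measurable_fun (annulus r) (w \o row_of).
Proof.
by apply: measurable_funS (measurable_eball x r) _ measurable_w; rewrite annulusE => t [].
Qed.

Let measurable_rho : measurable_fun setT (fun t : n.+1.-tuple R => rho t).
Proof. exact: measurable_fun_enormB. Qed.

Lemma integrable_eball_layer_cake : (lebn n.+1).-integrable (row_of @^-1` eball x r)
  (fun t => (w (row_of t) * (r `^ p - rho t `^ p))%:E).
Proof.
have mpow : measurable_fun setT (fun t : n.+1.-tuple R => r `^ p - rho t `^ p).
  by apply: measurable_funB => //; apply: (measurableT_comp (f := fun s : R => s `^ p)).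
apply/(negligible_integrable (measurable_preimage_row_of_set1 x) _ _ (lebn_set1 x)).
- exact: measurable_eball.
- by apply/measurable_EFinP; apply: measurable_funM => //; exact: measurable_funTS.
have [C wC] := w_growth; rewrite -annulusE.
exact: (layer_cake_integrable r0 p0 measurable_rho measurable_w_annulus wC).
Qed.

Let eball_layersE s : 0 < s < r ->
  p * s `^ (p - 1) * \int[lebesgue_tuple n.+1]_(t in annulus s) w (row_of t) =
  p * s `^ (p - 1) * \int[lebn n.+1]_(t in row_of @^-1` eball x s) w (row_of t).
Proof. by move=> /andP[_ /ltW sr]; rewrite integral_annulus//; exact: integrable_w. Qed.

Lemma integrable_eball_layers : lam.-integrable `]0, r[ (fun s =>
  (p * s `^ (p - 1) * \int[lebn n.+1]_(t in row_of @^-1` eball x s) w (row_of t))%:E).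
Proof.
have [C wC] := w_growth.
apply: eq_integrable (integrable_layers r0 p0 measurable_rho measurable_w_annulus wC) => //.
by move=> s; rewrite inE/= in_itv/= => /eball_layersE ->.
Qed.

Lemma eball_layer_cake :
  \int[lebn n.+1]_(t in row_of @^-1` eball x r) (w (row_of t) * (r `^ p - rho t `^ p)) =
  \int[lam]_(s in `]0, r[)
    (p * s `^ (p - 1) * \int[lebn n.+1]_(t in row_of @^-1` eball x s) w (row_of t)).
Proof.
have [C wC] := w_growth; rewrite integral_annulus; last exact: integrable_eball_layer_cake.
rewrite [LHS](layer_cake r0 p0 measurable_rho measurable_w_annulus wC).
by apply: eq_Rintegral => s; rewrite inE/= in_itv/= => /eball_layersE.
Qed.

End layer_cake_on_balls.

Section power_law.
Context {R : realType}.
Local Notation lam := (@lebesgue_measure R).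
Variables (g : R -> R) (k r : R).
Hypothesis integrable_g : lam.-integrable `]0, r[ (EFin \o g).
Hypothesis g_integral : forall s, 0 < s < r -> s * g s = k * \int[lam]_(a in `]0, s[) g a.

Let f := g \_ `]0, r[.
Let G s := parameterized_integral lam 0 s f.

Let integrable_f (A : set R) : measurable A -> lam.-integrable A (EFin \o f).
Proof.
move=> mA; apply: (integrableS measurableT) => //.
have m0r : measurable (`]0, r[%classic : set (measurableTypeR R)) by exact: measurable_itv.
by rewrite -restrict_EFin; exact/(integrable_mkcond _ m0r).
Qed.

Let fE s : 0 < s < r -> f s = k * G s / s.
Proof.
move=> /[dup] sr /andP[s0 _]; have -> : f s = g s by rewrite /f patchE mem_set//= in_itv.
apply: (mulfI (lt0r_neq0 s0)); rewrite g_integral// [RHS]mulrC divfK ?gt_eqF//; congr (_ * _).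
rewrite /G /parameterized_integral -Rintegral_itv_obnd_cbnd; last exact: integrable_f.
rewrite -Rintegral_itv_bndo_bndc; last exact: integrable_f.
apply: eq_Rintegral => a; rewrite inE/= in_itv/= => /andP[a0 sa].
by rewrite /f patchE mem_set//= in_itv/= a0 (lt_trans sa)//; case/andP: sr.
Qed.

Let near_lt0r s : 0 < s < r -> \forall a \near s, 0 < a < r.
Proof.
move=> sr; apply: filterS (near_in_itvoo _); last by rewrite in_itv; exact: sr.
by move=> a; rewrite in_itv.
Qed.

Let continuous_G s : 0 < s < r -> {for s, continuous G}.
Proof.
move=> /andP[s0 sr]; have r0 := lt_trans s0 sr.
have := parameterized_integral_continuous (ltW r0) (integrable_f (measurable_itv _)).
by move=> /(continuous_within_itvP _ r0)[cG _ _]; apply: cG; rewrite in_itv/= s0.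
Qed.

Let continuous_f s : 0 < s < r -> {for s, continuous f}.
Proof.
move=> sr; have /andP[s0 _] := sr.
have cq : {for s, continuous (fun a => k * G a / a)}.
  apply: continuousM; last first.
    by apply: (@continuousV _ _ id); [exact: lt0r_neq0|exact: cvg_id].
  by apply: continuousM; [exact: cst_continuous|exact: continuous_G].
rewrite /prop_for /continuous_at fE//; apply: cvg_trans cq.
by apply: near_eq_cvg; near=> a; rewrite fE//; near: a; exact: near_lt0r.
Unshelve. all: by end_near. Qed.

Let is_derive_G s : 0 < s < r -> is_derive s 1 G (f s).
Proof.
move=> /[dup] sr /andP[s0 s_lt_r].
have f_itv := integrable_f (measurable_itv `[0, r]).
have [dG <-] := continuous_FTC1_closed s_lt_r f_itv s0 (continuous_f sr).
by rewrite derive1E; exact: derivableP.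
Qed.

(* [k G(s) = s G'(s)], so that [G(s) s^(-k)] is constant. *)
Lemma power_law_of_integral s t : 0 < s < r -> 0 < t < r ->
  g s / s `^ (k - 1) = g t / t `^ (k - 1).
Proof.
have gE a : 0 < a < r -> g a / a `^ (k - 1) = k * (G a * a `^ (- k)).
  move=> /[dup] ar /andP[a0 _]; have <- : f a = g a by rewrite /f patchE mem_set//= in_itv.
  have ak0 : a `^ k != 0 by rewrite gt_eqF ?powR_gt0.
  rewrite fE// powRN powRB ?powRr1 ?(ltW a0) ?(gt_eqF a0) ?implybT//; field.
  by rewrite ak0 (gt_eqF a0).
have derive_G_powR a : 0 < a < r -> is_derive a 1 (G * (@powR R ^~ (- k))) 0.
  move=> /[dup] ar /andP[a0 _].
  apply: is_derive_eq (is_deriveM (is_derive_G ar) (is_derive1_powR _ a0)) _.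
  rewrite fE// powRB ?powRr1 ?(ltW a0) ?(gt_eqF a0) ?implybT// /GRing.scale/=; field.
  by rewrite (gt_eqF a0).
wlog st : s t / s <= t => [constH sr tr|sr tr].
  by have [st|/ltW ts] := leP s t; [|apply/esym]; apply: constH.
rewrite !gE//; congr (_ * _); apply/eqP; rewrite eq_sym -subr_eq0; apply/eqP.
have [||a _ ->] := MVT_segment (f := G * (@powR R ^~ (- k))) (df := fun=> 0) st.
- move=> a; rewrite in_itv/= => /andP[sa a_lt_t]; apply: derive_G_powR.
  by move: sr tr => /andP[s0 _] /andP[_ tr]; rewrite (lt_trans s0 sa) (lt_trans a_lt_t).
- apply: derivable_within_continuous => a; rewrite in_itv/= => /andP[sa a_lt_t].
  suff /derive_G_powR dG : 0 < a < r by exact: ex_derive.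
  by move: sr tr => /andP[s0 _] /andP[_ tr]; rewrite (lt_le_trans s0) // (le_lt_trans a_lt_t).
by rewrite mul0r.
Qed.

End power_law.

Section coordinates.
Context {R : realType} {n : nat}.
Implicit Types (x y v : 'rV[R]_n) (s : R).

Lemma continuous_coordB x (j : 'I_n) : continuous (fun y => (y - x) ord0 j).
Proof.
move=> y; apply: (@continuous_comp _ _ _ (fun y => y - x) (fun v => v ord0 j)).
  by apply: continuousB => //; exact: cst_continuous.
exact: coord_continuous.
Qed.

Lemma is_derive_coordB x y v (j : 'I_n) : is_derive y v (fun y => (y - x) ord0 j) (v ord0 j).
Proof.
have quotientE : \forall h \near (0 : R)^',
    h^-1 *: ((h *: v + y - x) ord0 j - (y - x) ord0 j) = v ord0 j.
  near=> h; have h0 : h != 0 by near: h; exact: nbhs_dnbhs_neq.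
  by rewrite !mxE opprB addrA subrK addrK [_ *: _]mulKf.
by apply: DeriveDef; [exact: is_cvg_near_cst quotientE|exact: lim_near_cst quotientE].
Unshelve. all: by end_near. Qed.

Lemma is_derive_enormB_sqr x y (i : 'I_n) :
  is_derive y (delta_mx ord0 i) (fun y => enorm (y - x) ^+ 2) (2 * (y - x) ord0 i).
Proof.
have -> : (fun y => enorm (y - x) ^+ 2) = \sum_j (fun y => (y - x) ord0 j) ^+ 2.
  by apply/funext => z; rewrite enorm_sqr fct_sumE.
have dcoord j := is_derive_coordB x y (delta_mx ord0 i) j.
apply: is_derive_eq; rewrite (bigD1 i)//= big1 => [|j ji].
  by rewrite [delta_mx _ _ _ _]mxE !eqxx addr0 [_ *: 1]mulr1.
by rewrite [delta_mx _ _ _ _]mxE eqxx (negbTE ji) scaler0.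
Qed.

Lemma continuous_enormB_sqr x : continuous (fun y => enorm (y - x) ^+ 2).
Proof.
move=> y; apply: (@continuous_comp _ _ _ (fun y => enorm (y - x)) (fun a => a ^+ 2)).
  exact: continuous_enormB.
exact: exprn_continuous.
Qed.

Definition paraboloid x s y : R := (enorm (y - x) ^+ 2 - s ^+ 2) / 2.

Lemma paraboloid_sphere x s y : enorm (y - x) = s -> paraboloid x s y = 0.
Proof. by move=> ys; rewrite /paraboloid ys subrr mul0r. Qed.

Lemma continuous_paraboloid x s : continuous (paraboloid x s).
Proof.
move=> y; apply: (@continuousM _ _ (fun y => enorm (y - x) ^+ 2 - s ^+ 2) (cst 2^-1)).
  apply: (@continuousB _ _ _ (fun y => enorm (y - x) ^+ 2) (cst (s ^+ 2))).
    exact: continuous_enormB_sqr.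
  exact: cst_continuous.
exact: cst_continuous.
Qed.

Lemma is_derive_paraboloid x s y (i : 'I_n) :
  is_derive y (delta_mx ord0 i) (paraboloid x s) ((y - x) ord0 i).
Proof.
have -> : paraboloid x s = 2^-1 \*: ((fun y => enorm (y - x) ^+ 2) - cst (s ^+ 2)).
  by apply/funext => z; rewrite /paraboloid mulrC.
have denormB_sqr := is_derive_enormB_sqr x y i.
by apply: is_derive_eq; rewrite subr0 /GRing.scale/= mulKf.
Qed.

End coordinates.

Section paraboloid_layer_cake.
Context {R : realType} {n : nat}.
Local Notation lam := (@lebesgue_measure R).
Variables (w : 'rV[R]_n.+1 -> R) (K : set 'rV[R]_n.+1) (x : 'rV[R]_n.+1) (r : R).
Hypotheses (r0 : 0 < r) (compactK : compact K) (xrK : eball x r `<=` K).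
Hypothesis cw : forall y, K y -> {for y, continuous w}.
Local Notation W s := (\int[lebn n.+1]_(t in row_of @^-1` eball x s) w (row_of t)).

Let p0 : 0 < 2 + n.+1%:R :> R. Proof. by rewrite addr_gt0. Qed.

Let layerE s : s \in (`]0, r[%classic : set R) -> 2 * s `^ (2 - 1) * W s = 2 * (s * W s).
Proof. by rewrite inE/= in_itv/= => /andP[/ltW s0 _]; rewrite addrK powRr1// mulrA. Qed.

Lemma integrable_layer_moment : lam.-integrable `]0, r[ (fun s => (s * W s)%:E).
Proof.
have m0r : measurable (`]0, r[%classic : set (measurableTypeR R)) by exact: measurable_itv.
have := integrableZl m0r 2^-1 (integrable_eball_layers r0 p0 compactK xrK cw).
apply: eq_integrable => // s /layerE sE; rewrite -EFinM; congr EFin.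
by rewrite sE mulKf.
Qed.

Lemma integral_mul_paraboloid :
  \int[lebn n.+1]_(t in row_of @^-1` eball x r) (w (row_of t) * paraboloid x r (row_of t)) =
  - \int[lam]_(s in `]0, r[) (s * W s).
Proof.
have integrable_wp : (lebn n.+1).-integrable (row_of @^-1` eball x r)
    (fun t => (w (row_of t) * paraboloid x r (row_of t))%:E).
  apply: (@integrable_continuous_row_of _ _ _ _ (fun y => w y * paraboloid x r y) _ compactK xrK).
    exact: open_eball.
  move=> y Ky.
  have cparaboloid : {for y, continuous (paraboloid x r)} by exact: continuous_paraboloid.
  exact: continuousM (cw Ky) cparaboloid.
apply: (mulfI (_ : - 2 != 0)); first by rewrite oppr_eq0.
rewrite -RintegralZl//; last exact: measurable_eball.
rewrite mulrNN -RintegralZl//; last exact: integrable_layer_moment.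
transitivity (\int[lam]_(s in `]0, r[) (2 * s `^ (2 - 1) * W s)); last exact: eq_Rintegral.
rewrite -(eball_layer_cake r0 p0 compactK xrK cw); apply: eq_Rintegral => t _.
by rewrite !powR_mulrn ?enorm_ge0 ?(ltW r0)// /paraboloid; field.
Qed.

End paraboloid_layer_cake.

Definition radial_derivative {R : realType} {n : nat} (u : 'rV[R]_n -> R) (x y : 'rV[R]_n) : R :=
  \sum_i partial i u y * (y - x) ord0 i.

Section harmonic_functions.
Context {R : realType} {n : nat}.
Local Notation lam := (@lebesgue_measure R).
Local Notation B x s := (@row_of R n.+1 @^-1` eball x s).
Variables (D : set 'rV[R]_n.+1) (u : 'rV[R]_n.+1 -> R) (x : 'rV[R]_n.+1) (r : R).
Hypothesis harmonic_u : is_harmonic D u.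
Hypothesis xrD : closed_eball x r `<=` D.

Let sub_D s : s <= r -> closed_eball x s `<=` D.
Proof. by move=> sr y ys; apply: xrD; exact: le_trans ys sr. Qed.

Let continuous_u y : D y -> {for y, continuous u}.
Proof. by move=> Dy; have [/(_ _ Dy)[]] := harmonic_u. Qed.

Let continuous_partial i y : D y -> {for y, continuous (partial i u)}.
Proof. by move=> Dy; have [/(_ _ Dy)[_ /(_ i)[_ []]]] := harmonic_u. Qed.

Let continuous_partial2 i y : D y -> {for y, continuous (partial i (partial i u))}.
Proof. by move=> Dy; have [/(_ _ Dy)[_ /(_ i)[_ [_ /(_ i)[]]]]] := harmonic_u. Qed.

Let is_derive_u i y : D y -> is_derive y (delta_mx ord0 i) u (partial i u y).
Proof. by move=> Dy; apply: derivableP; have [/(_ _ Dy)[_ /(_ i)[]]] := harmonic_u. Qed.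

Let is_derive_partial i y :
  D y -> is_derive y (delta_mx ord0 i) (partial i u) (partial i (partial i u) y).
Proof.
by move=> Dy; apply: derivableP; have [/(_ _ Dy)[_ /(_ i)[_ [_ /(_ i)[]]]]] := harmonic_u.
Qed.

Let continuous_radial y : D y -> {for y, continuous (radial_derivative u x)}.
Proof.
move=> Dy; apply: (cvg_big add_continuous (nbhs_filter y)) => i _.
by apply: (@continuousM _ _ (partial i u) (fun y => (y - x) ord0 i));
  [exact: continuous_partial|exact: continuous_coordB].
Qed.

Let integrable_continuous s (f : 'rV[R]_n.+1 -> R) : s <= r ->
  (forall y, D y -> {for y, continuous f}) ->
  (lebn n.+1).-integrable (B x s) (EFin \o (f \o row_of)).
Proof.
by move=> sr cf; apply: integrable_continuous_eball => y /(sub_D sr); exact: cf.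
Qed.

(* The field [y |-> grad u (y) * (|y - x|^2 - s^2) / 2] vanishes on the sphere and, [u] being
   harmonic, its divergence is [radial_derivative u x]. *)
Lemma integral_radial_derivative s : 0 < s <= r ->
  \int[lebn n.+1]_(t in B x s) radial_derivative u x (row_of t) = 0.
Proof.
move=> /andP[s0 /sub_D xsD].
pose g i := partial i u * paraboloid x s.
pose dg i y := partial i u y * (y - x) ord0 i + paraboloid x s y * partial i (partial i u) y.
rewrite -[RHS](@integral_divergence_eq0 _ _ x s g dg)//; last 3 first.
- move=> i y /xsD Dy; apply: is_deriveM (is_derive_partial i Dy) (is_derive_paraboloid x s y i).
- move=> i y /xsD Dy.
  have ccoord : {for y, continuous (fun y : 'rV[R]_n.+1 => (y - x) ord0 i)}.
    exact: continuous_coordB.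
  have cparaboloid : {for y, continuous (paraboloid x s)} by exact: continuous_paraboloid.
  exact: (continuousD (continuousM (@continuous_partial i y Dy) ccoord)
    (continuousM cparaboloid (@continuous_partial2 i y Dy))).
- move=> i y ys; rewrite /g -[LHS]/(partial i u y * paraboloid x s y).
  by rewrite paraboloid_sphere// mulr0.
apply: eq_Rintegral => t; rewrite inE => /eball_sub_closed_eball/xsD Dt.
rewrite big_split/= -mulr_sumr; have [_ ->] // := harmonic_u.
by rewrite mulr0 addr0.
Qed.

Lemma integral_position_divergence s : 0 < s <= r ->
  \int[lebn n.+1]_(t in B x s)
    (radial_derivative u x (row_of t) * paraboloid x s (row_of t) +
     n.+3%:R * (u (row_of t) * paraboloid x s (row_of t)) + s ^+ 2 * u (row_of t)) = 0.
Proof.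
move=> /andP[s0 /sub_D xsD].
pose g i := u * ((fun y => (y - x) ord0 i) * paraboloid x s).
pose dg i y := u y * ((y - x) ord0 i * (y - x) ord0 i + paraboloid x s y) +
  (y - x) ord0 i * paraboloid x s y * partial i u y.
rewrite -[RHS](@integral_divergence_eq0 _ _ x s g dg)//; last 3 first.
- move=> i y /xsD Dy; have dcoord := is_derive_coordB x y (delta_mx ord0 i) i.
  apply: is_derive_eq (is_deriveM (is_derive_u i Dy)
    (is_deriveM dcoord (is_derive_paraboloid x s y i))) _.
  by rewrite [delta_mx _ _ _ _]mxE !eqxx /GRing.scale/= mulr1.
- move=> i y /xsD Dy.
  have ccoord : {for y, continuous (fun y : 'rV[R]_n.+1 => (y - x) ord0 i)}.
    exact: continuous_coordB.
  have cparaboloid : {for y, continuous (paraboloid x s)} by exact: continuous_paraboloid.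
  exact: (continuousD
    (continuousM (continuous_u Dy) (continuousD (continuousM ccoord ccoord) cparaboloid))
    (continuousM (continuousM ccoord cparaboloid) (@continuous_partial i y Dy))).
- move=> i y ys; rewrite /g -[LHS]/(u y * ((y - x) ord0 i * paraboloid x s y)).
  by rewrite paraboloid_sphere// !mulr0.
apply: eq_Rintegral => t _; set y := row_of t.
rewrite big_split/= -mulr_sumr big_split/= sumr_const card_ord.
have -> : \sum_i (y - x) ord0 i * (y - x) ord0 i = 2 * paraboloid x s y + s ^+ 2.
  by rewrite /paraboloid mulrC divfK// subrK enorm_sqr.
rewrite (eq_bigr (fun i => partial i u y * (y - x) ord0 i * paraboloid x s y)).
  rewrite -mulr_suml -/(radial_derivative u x y) -natr1 -natr1 -mulr_natl; ring.
by move=> i _; ring.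
Qed.

Local Notation Phi s := (\int[lebn n.+1]_(t in B x s) u (row_of t)).

Let integral_mul_paraboloid_D s (w : 'rV[R]_n.+1 -> R) : 0 < s <= r ->
  (forall y, D y -> {for y, continuous w}) ->
  \int[lebn n.+1]_(t in B x s) (w (row_of t) * paraboloid x s (row_of t)) =
  - \int[lam]_(a in `]0, s[) (a * \int[lebn n.+1]_(t in B x a) w (row_of t)).
Proof.
move=> /andP[s0 sr] cw; apply: (integral_mul_paraboloid s0 (@compact_closed_eball _ _ x s)).
  exact: eball_sub_closed_eball.
by move=> y /(sub_D sr); exact: cw.
Qed.

Lemma integral_radial_derivative_paraboloid s : 0 < s <= r ->
  \int[lebn n.+1]_(t in B x s)
    (radial_derivative u x (row_of t) * paraboloid x s (row_of t)) = 0.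
Proof.
move=> /[dup] sr /andP[_ s_le_r]; rewrite integral_mul_paraboloid_D// -[RHS]oppr0.
congr (- _); transitivity (\int[lam]_(a in `]0, s[) (0 : R)); last first.
  by rewrite Rintegral_cst// mul0r.
apply: eq_Rintegral => a; rewrite inE/= in_itv/= => /andP[a0 /ltW a_le_s].
by rewrite integral_radial_derivative ?mulr0// a0 (le_trans a_le_s).
Qed.

Lemma ball_integral_Euler s : 0 < s <= r ->
  s * (s * Phi s) = n.+3%:R * \int[lam]_(a in `]0, s[) (a * Phi a).
Proof.
move=> /[dup] sr /andP[_ s_le_r].
have cparaboloid y : {for y, continuous (paraboloid x s)} by exact: continuous_paraboloid.
have cu_paraboloid y : D y -> {for y, continuous (fun y => u y * paraboloid x s y)}.
  by move=> Dy; exact: continuousM (continuous_u Dy) (cparaboloid y).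
have cradial_paraboloid y : D y ->
    {for y, continuous (fun y => radial_derivative u x y * paraboloid x s y)}.
  by move=> Dy; exact: continuousM (continuous_radial Dy) (cparaboloid y).
have continuous_scale (k : R) (w : 'rV[R]_n.+1 -> R) y :
    {for y, continuous w} -> {for y, continuous (fun y => k * w y)}.
  by move=> cw; exact: continuousM (@cst_continuous _ _ k y) cw.
have integrable_D (w : 'rV[R]_n.+1 -> R) := @integrable_continuous s w s_le_r.
have mB := measurable_eball x s.
have := integral_position_divergence sr; rewrite RintegralD//; last 2 first.
- apply: (integrable_D (fun y => radial_derivative u x y * paraboloid x s y +
    n.+3%:R * (u y * paraboloid x s y))) => y Dy.
  exact: continuousD (cradial_paraboloid y Dy) (continuous_scale _ _ _ (cu_paraboloid y Dy)).
- apply: (integrable_D (fun y => s ^+ 2 * u y)) => y Dy.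
  by apply: continuous_scale; exact: continuous_u.
rewrite RintegralD//; last 2 first.
- exact: integrable_D cradial_paraboloid.
- apply: (integrable_D (fun y => n.+3%:R * (u y * paraboloid x s y))) => y Dy.
  by apply: continuous_scale; exact: cu_paraboloid.
rewrite !RintegralZl//; [|exact: integrable_D continuous_u|exact: integrable_D cu_paraboloid].
rewrite integral_radial_derivative_paraboloid// integral_mul_paraboloid_D// add0r; lra.
Qed.

Lemma ball_integral_power_law s t : 0 < s < r -> 0 < t < r ->
  Phi s / s ^+ n.+1 = Phi t / t ^+ n.+1.
Proof.
move=> sr tr; have r0 : 0 < r by case/andP: sr => s0 /(lt_trans s0).
have moment_powR a : 0 < a -> a * Phi a / a `^ (n.+3%:R - 1) = Phi a / a ^+ n.+1.
  move=> a0; have -> : n.+3%:R - 1 = n.+2%:R :> R by rewrite -natr1 addrK.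
  by rewrite powR_mulrn ?(ltW a0)// [a ^+ n.+2]exprS -mulf_div divff ?gt_eqF// mul1r.
have /andP[s0 _] := sr; have /andP[t0 _] := tr.
rewrite -!moment_powR//.
apply: (@power_law_of_integral _ (fun a => a * Phi a) n.+3%:R r _ _ s t sr tr).
  apply: (integrable_layer_moment r0 (@compact_closed_eball _ _ x r)).
    exact: eball_sub_closed_eball.
  by move=> y /xrD; exact: continuous_u.
by move=> a /andP[a0 ar]; apply: ball_integral_Euler; rewrite a0 ltW.
Qed.

Lemma harmonic_mean_value s : 0 < s < r -> Phi s = ball_vol n.+1 s * u x.
Proof.
move=> /[dup] sr /andP[s0 s_lt_r]; have r0 := lt_trans s0 s_lt_r.
have Dx : D x by apply: xrD; exact: eball_sub_closed_eball (eball_center x r0).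
suff density : Phi s / s ^+ n.+1 = ball_vol n.+1 (1 : R) * u x.
  by rewrite ball_volE// -mulrA -density mulrC divfK// expf_neq0 ?gt_eqF.
apply/eqP; rewrite -subr_eq0 -normr_le0; apply/ler_addgt0Pr => e e0; rewrite add0r.
have v0 := ball_vol_gt0 n.+1 (@ltr01 R).
have /cvgrPdist_le/(_ (e / ball_vol n.+1 1)) := continuous_u Dx.
rewrite divr_gt0// => /(_ isT)/nbhs_ballP[d /= d0 ud].
pose a := Num.min d s; have a0 : 0 < a by rewrite lt_min d0.
have ar : 0 < a < r by rewrite a0 gt_min s_lt_r orbT.
have dist_u t : eball x a (row_of t) -> `|u (row_of t) - u x| <= e / ball_vol n.+1 1.
  move=> ta; rewrite distrC; apply: ud; rewrite -ball_normE /= distrC.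
  by rewrite (le_lt_trans (norm_le_enorm _))// (lt_le_trans ta)// ge_min lexx.
rewrite (ball_integral_power_law sr ar).
have := Rintegral_eball_dist a0 (integrable_continuous (ltW (andP ar).2) continuous_u) dist_u.
have am0 : 0 < a ^+ n.+1 by rewrite exprn_gt0.
have -> : Phi a / a ^+ n.+1 - ball_vol n.+1 1 * u x =
    (Phi a - a ^+ n.+1 * ball_vol n.+1 1 * u x) / a ^+ n.+1.
  by field; rewrite lt0r_neq0.
rewrite ball_volE// normrM normfV (gtr0_norm am0) ler_pdivrMr// => /le_trans; apply.
by rewrite -mulrA [_ * (e / _)]mulrC divfK ?lt0r_neq0// mulrC.
Qed.

End harmonic_functions.

Section power_kernels.
Context {R : realType} {n : nat}.
Local Notation m := n.+1.
Local Notation lam := (@lebesgue_measure R).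
Implicit Types (x : 'rV[R]_m) (r p : R).

Lemma integrable_power_kernel x r p (A : set 'rV[R]_m) :
  open A -> bounded_set A -> 0 < p + m%:R ->
  (lebn m).-integrable (row_of @^-1` A) (fun t => (r `^ p - enorm (x - row_of t) `^ p)%:E).
Proof.
move=> oA /(bounded_set_sub_eball x)[s s0 As] pm.
have mA := measurable_preimage_row_of oA.
apply: (integrableS (measurable_eball x s) mA) => [t /As//|].
have ks := integrable_eball_layer_cake s0 pm (@compact_closed_eball _ _ x s)
  (@eball_sub_closed_eball _ _ x s) (fun y _ => @cst_continuous _ _ (1 : R) y).
have k0 : (lebn m).-integrable (row_of @^-1` eball x s) (EFin \o cst (r `^ p - s `^ p)).
  by apply: (integrable_continuous_eball (f := cst _)) => y _; exact: cst_continuous.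
have := integrableD (measurable_eball x s) ks k0.
apply: eq_integrable; first exact: measurable_eball.
by move=> t _; rewrite /= -EFinD enorm_distC; congr EFin; ring.
Qed.

Variables (D : set 'rV[R]_m) (u : 'rV[R]_m -> R) (x : 'rV[R]_m) (r p : R).
Hypotheses (harmonic_u : is_harmonic D u) (r0 : 0 < r) (xrD : closure (eball x r) `<=` D).
Hypothesis pm : 0 < p + m%:R.

Let continuous_u y : closure (eball x r) y -> {for y, continuous u}.
Proof. by move=> /xrD Dy; have [/(_ _ Dy)[]] := harmonic_u. Qed.

Let eball_mean_value s : 0 < s < r ->
  \int[lebn m]_(t in row_of @^-1` eball x s) u (row_of t) = ball_vol m s * u x.
Proof.
move=> /andP[s0 sr]; apply: (harmonic_mean_value harmonic_u (r := (s + r) / 2)); last by lra.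
move=> y ys; apply: xrD; apply: subset_closure; rewrite /eball/=.
by apply: le_lt_trans ys _; lra.
Qed.

Let integrable_kernel : (lebn m).-integrable (row_of @^-1` eball x r)
  (fun t => (u (row_of t) * (r `^ p - enorm (x - row_of t) `^ p))%:E).
Proof.
apply: eq_integrable (integrable_eball_layer_cake r0 pm (@compact_closure_eball _ _ x r)
  (@subset_closure _ _) continuous_u); first exact: measurable_eball.
by move=> t _; rewrite enorm_distC.
Qed.

Lemma integral_power_kernel :
  \int[lebn m]_(t in row_of @^-1` eball x r)
    (u (row_of t) * (r `^ p - enorm (x - row_of t) `^ p)) =
  ball_vol m r * (p / (p + m%:R) * r `^ p * u x).
Proof.
under eq_Rintegral do rewrite enorm_distC.
rewrite (eball_layer_cake r0 pm (@compact_closure_eball _ _ x r) (@subset_closure _ _)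
  continuous_u).
pose k := p / (p + m%:R) * (ball_vol m 1 * u x).
transitivity (\int[lam]_(s in `]0, r[) (k * ((p + m%:R) * s `^ (p + m%:R - 1)))).
  apply: eq_Rintegral => s; rewrite inE/= in_itv/= => /[dup] sr /andP[s0 _].
  have -> : (p + m%:R - 1) = (p - 1) + m%:R by ring.
  rewrite eball_mean_value// ball_volE// [s `^ (_ + m%:R)]powRD ?(gt_eqF s0) ?implybT//.
  rewrite powR_mulrn ?(ltW s0)// /k.
  by field; rewrite nat1r lt0r_neq0.
rewrite RintegralZl//; last exact: integrable_powR_itv0o.
rewrite /Rintegral integral_powR_itv0o// powRD ?(gt_eqF r0) ?implybT//.
by rewrite powR_mulrn ?(ltW r0)// ball_volE// /k /=; ring.
Qed.

Lemma weighted_mean_value :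
  (((ball_vol m r)^-1)%:E * \int[lebn m]_(t in row_of @^-1` eball x r)
    (u (row_of t) * (r `^ p - enorm (x - row_of t) `^ p))%:E =
   (p / (p + m%:R) * r `^ p * u x)%:E)%E.
Proof.
rewrite -[X in (_ * X)%E]fineK; last first.
  by apply: integrable_fin_num integrable_kernel; exact: measurable_eball.
by rewrite -EFinM -/(Rintegral _ _ _) integral_power_kernel mulKf// lt0r_neq0// ball_vol_gt0.
Qed.

Lemma weighted_mean_value_opp :
  (((ball_vol m r)^-1)%:E * \int[lebn m]_(t in row_of @^-1` eball x r)
    (u (row_of t) * (enorm (x - row_of t) `^ p - r `^ p))%:E =
   (- (p / (p + m%:R)) * r `^ p * u x)%:E)%E.
Proof.
have -> : - (p / (p + m%:R)) * r `^ p * u x = - 1 * (p / (p + m%:R) * r `^ p * u x) by ring.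
rewrite EFinM -weighted_mean_value muleCA; congr (_ * _)%E.
rewrite -integralZl//; last exact: measurable_eball.
by apply: eq_integral => t _; rewrite -EFinM; congr EFin; ring.
Qed.

End power_kernels.

Theorem theorem4 (R : realType) (m : nat) (hm : (2 <= m)%N) :
  (forall (D : set 'rV[R]_m) (u : 'rV[R]_m -> R),
     is_domain D -> is_harmonic D u ->
     forall (x : 'rV[R]_m) (r : R), D x -> 0 < r -> closure (eball x r) `<=` D ->
     (forall a : R, 0 < a < m%:R ->
        ((m%:R / a - 1) * r `^ (a - m%:R) * u x)%:E =
        (((ball_vol m r)^-1)%:E *
         \int[lebn m]_(t in [set t | eball x r (row_of t)])
           (u (row_of t) * (enorm (x - row_of t) `^ (a - m%:R) - r `^ (a - m%:R)))%:E)%E)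
     /\
     (forall b : R, 0 < b ->
        ((1 - m%:R / (m%:R + b)) * r `^ b * u x)%:E =
        (((ball_vol m r)^-1)%:E *
         \int[lebn m]_(t in [set t | eball x r (row_of t)])
           (u (row_of t) * (r `^ b - enorm (x - row_of t) `^ b))%:E)%E))
  /\
  (forall (x : 'rV[R]_m) (r a b : R) (A : set 'rV[R]_m),
     0 < r -> 0 < a < m%:R -> 0 < b ->
     is_domain A -> bounded_set A ->
     (lebn m).-integrable [set t | A (row_of t)]
        (fun t => (enorm (x - row_of t) `^ (a - m%:R) - r `^ (a - m%:R))%:E)
     /\
     (lebn m).-integrable [set t | A (row_of t)]
        (fun t => (r `^ b - enorm (x - row_of t) `^ b)%:E)).
Proof.
case: m hm => [//|n] _; split.
  move=> D u _ harmonic_u x r _ r0 xrD; split => [a /andP[a0 _]|b b0].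
    have p0 : 0 < a - n.+1%:R + n.+1%:R by rewrite subrK.
    rewrite [RHS](weighted_mean_value_opp harmonic_u r0 xrD p0); congr (_ * _ * _)%:E.
    by rewrite subrK; field; exact: lt0r_neq0.
  have p0 : 0 < b + n.+1%:R by rewrite addr_gt0.
  rewrite [RHS](weighted_mean_value harmonic_u r0 xrD p0); congr (_ * _ * _)%:E.
  by rewrite [n.+1%:R + b]addrC; field; rewrite nat1r lt0r_neq0.
move=> x r a b A _ /andP[a0 _] b0 [_ [openA _]] boundedA; split.
  have p0 : 0 < a - n.+1%:R + n.+1%:R by rewrite subrK.
  have := integrableN (integrable_power_kernel x r openA boundedA p0).
  by apply: eq_integrable => [|t _]; [exact: measurable_preimage_row_of|rewrite /= opprB].
by apply: integrable_power_kernel => //; rewrite addr_gt0.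
Qed.
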